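(* For every subcubic graph $G$ (that is, every graph with maximum degree at most $3$), the list strong chromatic index of $G$ satisfies $\chi_{s,l}'(G) \le 10$.
   Context: Graphs are finite and simple. The distance between two edges of a graph $G$ is the distance between the corresponding vertices in the line graph of $G$; so two adjacent edges are at distance $1$, and two non-adjacent edges that are both adjacent to a common edge are at distance $2$. A strong edge-coloring of $G$ is an assignment of colors to the edges of $G$ in which any two distinct edges at distance at most $2$ receive distinct colors. A list assignment $L$ for $G$ assigns to each edge $e$ of $G$ a list (set) $L(e)$ of possible colors. $G$ is strong $L$-edge-colorable if it admits a strong edge-coloring $\varphi$ with $\varphi(e)\in L(e)$ for every $e\in E(G)$. $G$ is strong $k$-edge-choosable if it is strong $L$-edge-colorable for every list assignment $L$ with $|L(e)|\ge k$ for every $e\in E(G)$. The list strong chromatic index $\chi_{s,l}'(G)$ is the least $k$ such that $G$ is strong $k$-edge-choosable. *)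

(* Defs.v *)
From mathcomp Require Import all_boot finmap.
From mathcomp Require Import boolp.

Set Implicit Arguments.
Unset Strict Implicit.
Unset Printing Implicit Defensive.

Record sgraph := SGraph {
  vertex :> finType;
  adj : rel vertex;
  adj_sym : symmetric adj;
  adj_irrefl : irreflexive adj
}.

Definition degree (G : sgraph) (x : G) : nat := #|[set y | adj x y]|.

Definition max_degree (G : sgraph) : nat := \max_(x : G) degree x.

Definition subcubic (G : sgraph) : Prop := max_degree G <= 3.

Definition has_walk (G : sgraph) (n : nat) (x y : G) : bool :=
  [exists p : n.-tuple G, path (@adj G) x p && (last x p == y)].

(* Distance is a relation: vertices in different components are at no finite
   distance, so no value has to stand for infinity. *)
Definition at_distance (G : sgraph) (d : nat) (x y : G) : bool :=
  has_walk d x y && [forall m : 'I_d, ~~ has_walk m x y].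

Definition edges (G : sgraph) : {set {set G}} :=
  [set A | [exists x, exists y, adj x y && (A == [set x; y])]].

Definition edge (G : sgraph) : finType := {A : {set G} | A \in edges G}.

Definition edge_adj (G : sgraph) : rel (edge G) :=
  fun e f => (e != f) && (val e :&: val f != set0).

Lemma edge_adj_sym (G : sgraph) : symmetric (@edge_adj G).
Proof. by move=> e f; rewrite /edge_adj eq_sym setIC. Qed.

Lemma edge_adj_irrefl (G : sgraph) : irreflexive (@edge_adj G).
Proof. by move=> e; rewrite /edge_adj eqxx. Qed.

Definition line_graph (G : sgraph) : sgraph :=
  SGraph (@edge_adj_sym G) (@edge_adj_irrefl G).

Definition strong_edge_coloring (G : sgraph) (C : Type) (phi : edge G -> C) :
    Prop :=
  forall (e f : edge G) (d : nat),
    e <> f -> at_distance (G := line_graph G) d e f -> d <= 2 ->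
    phi e <> phi f.

(* Finite lists lose no generality: choosability only bounds list sizes from
   below, and a larger list may be replaced by any of its finite subsets. *)
Definition list_assignment (G : sgraph) (C : choiceType) : Type :=
  edge G -> {fset C}.

Definition strong_list_colorable (G : sgraph) (C : choiceType)
    (L : list_assignment G C) : Prop :=
  exists phi : edge G -> C,
    strong_edge_coloring phi /\ forall e, phi e \in L e.

Definition strong_choosable (G : sgraph) (k : nat) : Prop :=
  forall (C : choiceType) (L : list_assignment G C),
    (forall e, k <= #|` L e|) -> strong_list_colorable L.

Lemma strong_choosable_card_edge (G : sgraph) : strong_choosable G #|edge G|.
Proof.
move=> C L hL.
have base e : exists c, c \in L e.
  apply/fset0Pn; rewrite -cardfs_gt0; apply: leq_trans (hL e).
  by apply/card_gt0P; exists e.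
have inj (s : seq (edge G)) : uniq s -> exists phi : edge G -> C,
    (forall e, phi e \in L e) /\ {in s &, injective phi}.
  elim: s => [|a s IH] /=.
    by move=> _; exists (fun e => xchoose (base e)); split=> // e; exact: xchooseP.
  move=> /[dup] us /andP[aNs us'].
  have [phi [phiL phi_inj]] := IH us'.
  have [c cL cN] : exists2 c, c \in L a & c \notin map phi s.
    apply: contrapT => nc.
    have sub : {subset (L a : seq C) <= map phi s}.
      by move=> c cL; apply: contrapT => /negP cN; apply: nc; exists c.
    have := uniq_leq_size (fset_uniq (L a)) sub; rewrite size_map leqNgt.
    move/negP; apply; apply: leq_trans (hL a).
    rewrite -[_.+1]/(size (a :: s)) cardE; apply: uniq_leq_size => // x _.
    exact: mem_enum.
  exists (fun e => if e == a then c else phi e); split=> [e|x y].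
    by case: eqP => [->|].
  rewrite !inE; case: eqVneq => [->|_] /= xs; case: eqVneq => [->|_] //= ys.
  - by move=> cE; rewrite cE map_f in cN.
  - by move=> cE; rewrite -cE map_f in cN.
  - exact: phi_inj.
have [phi [phiL phi_inj]] := inj _ (enum_uniq (edge G)).
exists phi; split=> // e f d ef _ _ /phi_inj H; apply: ef; apply: H;
  exact: mem_enum.
Qed.

Lemma strong_choosable_ex (G : sgraph) :
  exists k, `[< strong_choosable G k >].
Proof. by exists #|edge G|; apply/asboolP/strong_choosable_card_edge. Qed.

Definition list_strong_chromatic_index (G : sgraph) : nat :=
  ex_minn (strong_choosable_ex G).

(* Main.v *)
From Stdlib Require Import BinInt.
Require Import Defs.
From mathcomp Require Import all_boot all_order all_algebra finmap boolp.
From mathcomp Require Import zify ssrZ.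

(** Two edges conflict when they are at distance at most 2.  An edge of a
subcubic graph conflicts with at most twelve others, so a plain greedy colouring
needs up to thirteen colours.  The proof works in one connected component and
combines a greedy colouring of most edges with an algebraic colouring of the
remaining ones, which lie around a shortest cycle.

Greedy part.  Fix a vertex v and colour the edges missing v, the ones far from
v first.  When the edge ab is coloured, some neighbour w of a has all its edges
still uncoloured, so ab sees at most nine colours and a tenth is available
([colorable_away]).  Hence for any set S of edges that contains the edges at v
it is enough to colour S itself, from lists whose sizes drop from ten by the
number of conflicts with edges outside S ([colorable_from_root]).  If v has
degree at most 2, the edges at v also have at most nine conflicts, and the
greedy colouring finishes ([colorable_deficient]).  Otherwise the component is
cubic and contains a cycle; S is chosen around a shortest one.

Algebraic part.  The product of the differences x - y over the conflicting
pairs of S is a polynomial which is nonzero exactly at the proper colourings.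
If its coefficient at a monomial of full degree is nonzero, then S can be
coloured from any lists whose sizes exceed the exponents of that monomial
([list_coloring_of_coefficient], the Combinatorial Nullstellensatz in the form
used by Alon and Tarsi).  Such coefficients are computed by multiplying the
factors one at a time.

Shortest cycle of length k at least 7.  Let S consist of the k rim edges of the
cycle and the k spokes leaving it.  Minimality of the cycle forbids every
conflict between spokes that are not consecutive, so S has the conflicts of a
circular chain of blocks (spoke, rim edge), each block in conflict with the two
next ones only ([near_cycle_edges]); rim edges keep six colours and spokes four.
Exponents are taken periodic except on a few blocks.  The partial products then
become stationary, so that the coefficients for all k take only finitely many
values, which are evaluated and nonzero ([coefficient_cycle]).

Shortest cycle of length at most 6.  Spokes can now meet or be adjacent in
several ways.  A finite case analysis explores the graph from the cycle, asking
whether two vertices are adjacent or introducing a new neighbour, until some set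
S with a nonzero coefficient is in sight.  This analysis is recorded in a
certificate that is checked by computation ([certified_sound]). *)

Set Implicit Arguments.
Unset Strict Implicit.
Unset Printing Implicit Defensive.

Import GRing.Theory Num.Theory.

(** * Coefficients of graph polynomials *)

(** A product of differences of variables is expanded along a list of slots, one
for each variable still in play: [Edge i j] multiplies by the difference of the
variables in slots i and j, and [Drop i] retires the variable in slot i once no
later factor involves it. *)
Inductive op := Edge of nat & nat | Drop of nat.

Definition decr (i : nat) (m : seq nat) : seq nat :=
  set_nth 0 m i (nth 0 m i).-1.

Definition remove (T : Type) (i : nat) (s : seq T) : seq T :=
  take i s ++ drop i.+1 s.

(** [vs] names the variables in the slots. *)
Fixpoint op_edges (T : Type) (x0 : T) (P : seq op) (vs : seq T) : seq (T * T) :=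
  match P with
  | [::] => [::]
  | Edge i j :: P' => (nth x0 vs i, nth x0 vs j) :: op_edges x0 P' vs
  | Drop i :: P' => op_edges x0 P' (remove i vs)
  end.

Definition op_size (o : op) (n : nat) : nat :=
  if o is Drop _ then n.-1 else n.

Definition op_indexed (n : nat) (o : op) : bool :=
  match o with
  | Edge i j => (i < n) && (j < n)
  | Drop i => i < n
  end.

Fixpoint well_indexed (n : nat) (P : seq op) : bool :=
  if P is o :: P' then op_indexed n o && well_indexed (op_size o n) P' else true.

Section Coefficient.
Local Open Scope ring_scope.

(** Here [m] lists what is left of the exponents of the target monomial: each
factor uses up one unit of one of its two variables.  Demanding that nothing is
left at [Drop] discards early the expansions that cannot reach the target. *)
Fixpoint coefficient (P : seq op) (m : seq nat) : rat :=
  match P with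
  | [::] => (all (pred1 0%N) m)%:R
  | Edge i j :: P' =>
      (if (0 < nth 0 m i)%N then coefficient P' (decr i m) else 0)
      - (if (0 < nth 0 m j)%N then coefficient P' (decr j m) else 0)
  | Drop i :: P' =>
      if nth 0%N m i == 0%N then coefficient P' (remove i m) else 0
  end.

Lemma size_decr i m : (i < size m)%N -> size (decr i m) = size m.
Proof. by move=> im; rewrite size_set_nth; apply/maxn_idPr. Qed.

Lemma size_remove T i (s : seq T) : (i < size s)%N -> size (remove i s) = (size s).-1.
Proof.
by move=> im; rewrite size_cat size_takel 1?ltnW // size_drop; lia.
Qed.

Lemma nth_remove T (x0 : T) i s j : (i < size s)%N ->
  nth x0 (remove i s) j = nth x0 s (if (j < i)%N then j else j.+1).
Proof.
move=> im; rewrite nth_cat (size_takel (ltnW im)); case: (ltnP j i) => ji.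
  exact: nth_take.
by rewrite nth_drop; congr nth; lia.
Qed.

Lemma perm_remove (T : eqType) (x0 : T) i s : (i < size s)%N ->
  perm_eq s (nth x0 s i :: remove i s).
Proof.
move=> im; rewrite -{1}(cat_take_drop i s) (drop_nth x0) //.
by rewrite perm_catC /= perm_cons perm_catC.
Qed.

Lemma op_edges_mem (T : eqType) (x0 : T) P vs p : well_indexed (size vs) P ->
  p \in op_edges x0 P vs -> (p.1 \in vs) && (p.2 \in vs).
Proof.
elim: P vs => [|[i j|i] P IH] vs //=.
  case/andP=> /andP[iv jv] /IH {}IH; rewrite in_cons => /orP[/eqP ->|/IH //].
  by rewrite !mem_nth.
case/andP=> iv; rewrite -(size_remove iv) => /IH {}IH /IH /andP[p1 p2].
by rewrite !(perm_mem (perm_remove x0 iv)) !inE p1 p2 !orbT.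
Qed.

Lemma nth_decr i j m : nth 0%N (decr i m) j =
  if j == i then (nth 0%N m i).-1 else nth 0%N m j.
Proof. by rewrite nth_set_nth /=. Qed.

Lemma sumn_decr i m : (0 < nth 0 m i)%N -> sumn m = (sumn (decr i m)).+1.
Proof.
elim: m i => [|a m IH] [|i] //=; first by case: a.
by move=> /IH ->; rewrite addnS.
Qed.

Lemma sumn_remove i m : nth 0%N m i = 0%N -> sumn (remove i m) = sumn m.
Proof.
rewrite /remove sumn_cat; elim: m i => [|a m IH] [|i] //=.
  by move=> ->; rewrite drop0.
by move=> /IH E; rewrite -E addnA.
Qed.

(** The product is homogeneous, of degree the number of its factors. *)
Lemma coefficient_sumn (T : Type) (x0 : T) P m vs :
  coefficient P m != 0 -> sumn m = size (op_edges x0 P vs).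
Proof.
elim: P m vs => [|[i j|i] P IH] m vs /=.
- have [m0 _|_] := boolP (all _ m); last by rewrite eqxx.
  by elim: m m0 => //= a m IHm /andP[/eqP -> /IHm].
- case: ifP => mi; case: ifP => mj.
  + move=> nz; have [z|] := eqVneq (coefficient P (decr i m)) 0.
      by move: nz; rewrite z sub0r oppr_eq0 => /(IH _ vs) /= <-; exact: sumn_decr.
    by move/(IH _ vs) <-; exact: sumn_decr.
  + by rewrite subr0 => /(IH _ vs) <-; exact: sumn_decr.
  + by rewrite sub0r oppr_eq0 => /(IH _ vs) <-; exact: sumn_decr.
  + by rewrite subr0 eqxx.
- by case: (nth 0%N m i =P 0%N) => [mi /(IH _ (remove i vs)) <-|_]; rewrite ?eqxx // sumn_remove.
Qed.

(** The weights of Lagrange interpolation on D + 1 points of A: they extract the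
coefficient of degree D from the values of a polynomial of degree at most D.
They exist because a Vandermonde matrix on distinct points is invertible. *)
Lemma lagrange_weights (N D : nat) (A : {set 'I_N}) : (D < #|A|)%N ->
  exists w : 'I_N -> rat, (forall c, w c != 0 -> c \in A) /\
    forall e, (e <= D)%N ->
      \sum_c w c * (c : nat)%:R ^+ e = (e == D)%:R.
Proof.
move=> DA.
have [s us [sA ss]] : exists2 s : seq 'I_N, uniq s & {subset s <= A} /\ size s = D.+1.
  exists (take D.+1 (enum A)); first by rewrite take_uniq ?enum_uniq.
  by split; [move=> c /mem_take; rewrite mem_enum | rewrite size_takel // -cardE].
case: s us sA ss => [//|c0 s] us sA ss.
move: (c0 :: s) us sA ss => t us sA ss {s}.
pose a : 'rV[rat]_D.+1 := \row_j (nth c0 t j : nat)%:R.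
pose V := Vandermonde D.+1 a.
have Vu : V \in unitmx.
  rewrite unitmxE det_Vandermonde unitfE; apply/prodf_neq0 => i _.
  apply/prodf_neq0 => j ij; rewrite !mxE subr_eq0 eqr_nat.
  by rewrite (inj_eq val_inj) nth_uniq ?ss // neq_ltn ij orbT.
pose x := invmx V *m (delta_mx ord_max 0 : 'cV_D.+1).
exists (fun c => if c \in t then x (inord (index c t)) 0 else 0); split.
  by move=> c; case: ifP => [ct _|_]; [apply: sA | rewrite eqxx].
move=> e eD; rewrite (bigID (mem t)) /= [X in _ + X]big1 ?addr0; last first.
  by move=> c /negPf ct; rewrite ct mul0r.
rewrite (eq_bigr (fun c => x (inord (index c t)) 0 * (c : nat)%:R ^+ e)); last first.
  by move=> c ->.
rewrite -big_uniq //= (big_nth c0) big_mkord ss.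
have eD' : (e < D.+1)%N by [].
transitivity ((V *m x) (Ordinal eD') 0).
  rewrite mxE; apply: eq_bigr => i _; rewrite [V _ _]mxE [a _ _]mxE mulrC.
  by congr (_ * _); rewrite index_uniq ?ss // inord_val.
by rewrite mulKVmx // mxE eqxx andbT.
Qed.
End Coefficient.

(** * Colourings from nonzero coefficients *)

Section GridSum.
Local Open Scope ring_scope.
Variables (V : finType) (N : nat) (w : V -> 'I_N -> rat) (D : V -> nat).

(** The weights act on each variable separately, so with Lagrange weights of
degrees [D] this sum extracts a coefficient from the values of a polynomial.  The
exponents [e] collect what has already been expanded. *)
Definition grid_sum (Es : seq (V * V)) (e : V -> nat) : rat :=
  \sum_(f : {ffun V -> 'I_N})
    (\prod_v (w v (f v) * (f v : nat)%:R ^+ e v)) *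
    \prod_(p <- Es) ((f p.1 : nat)%:R - (f p.2 : nat)%:R).

Definition bump_at (x : V) (e : V -> nat) (v : V) : nat := (v == x) + e v.

Lemma grid_sum_cons x y Es e : grid_sum ((x, y) :: Es) e =
  grid_sum Es (bump_at x e) - grid_sum Es (bump_at y e).
Proof.
have bumpE (f : {ffun V -> 'I_N}) z :
    \prod_v (w v (f v) * (f v : nat)%:R ^+ bump_at z e v) =
    (f z : nat)%:R * \prod_v (w v (f v) * (f v : nat)%:R ^+ e v).
  rewrite (bigD1 z) //= [in RHS](bigD1 z) //= /bump_at eqxx exprS.
  rewrite mulrCA -!mulrA; congr (_ * (_ * (_ * _))).
  by apply: eq_bigr => v /negPf ->.
rewrite /grid_sum -sumrB; apply: eq_bigr => f _.
by rewrite big_cons /= !bumpE mulrA [_ * (_ - _)]mulrC !mulrBl.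
Qed.

Hypothesis w_moment : forall v e, (e <= D v)%N ->
  \sum_c w v c * (c : nat)%:R ^+ e = (e == D v)%:R.

Lemma grid_sum_nil e : grid_sum [::] e =
  \prod_v \sum_c w v c * (c : nat)%:R ^+ e v.
Proof.
by rewrite bigA_distr_bigA; apply: eq_bigr => f _; rewrite big_nil mulr1.
Qed.

(** No factor can raise the exponent of x any more, and the weights at x
annihilate all exponents below D x. *)
Lemma grid_sum_low x Es e : (e x < D x)%N ->
  all (fun p => (p.1 != x) && (p.2 != x)) Es -> grid_sum Es e = 0.
Proof.
elim: Es e => [|[y z] Es IH] e ex /=.
  by move=> _; rewrite grid_sum_nil (bigD1 x) //= (w_moment (ltnW ex)) (ltn_eqF ex) mul0r.
rewrite grid_sum_cons => /andP[/andP[yx zx] /IH {}IH].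
by rewrite !IH ?subrr // /bump_at eq_sym ?(negPf yx) ?(negPf zx).
Qed.

Lemma sum_bump x e : (\sum_v bump_at x e v = (\sum_v e v).+1)%N.
Proof.
rewrite big_split /= (bigD1 x) //= eqxx big1 ?addn0 // => v /negPf ->.
by [].
Qed.

(** In an expanded monomial of the right total degree, an excess at x is
compensated by a deficit at another variable, whose weights annihilate it. *)
Lemma grid_sum_over x Es e : (\sum_v e v + size Es = \sum_v D v)%N ->
  (D x < e x)%N -> grid_sum Es e = 0.
Proof.
elim: Es e => [|[y z] Es IH] e /=.
  rewrite addn0 => eD ex.
  have [v ev] : exists v, (e v < D v)%N.
    apply/existsP; apply: contraLR ex => /existsPn le; rewrite -leqNgt.
    have: (\sum_(v | v != x) D v <= \sum_(v | v != x) e v)%N.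
      by apply: leq_sum => v _; rewrite leqNgt.
    by move: eD; rewrite (bigD1 x) //= [RHS](bigD1 x) //=; lia.
  exact: (@grid_sum_low v [::] e ev isT).
rewrite grid_sum_cons => eD ex.
rewrite !IH ?subrr // ?sum_bump ?(leq_trans ex) ?leq_addl //; lia.
Qed.

Lemma grid_sum_exact e : (forall v, e v = D v) -> grid_sum [::] e = 1.
Proof.
move=> eD; rewrite grid_sum_nil big1 // => v _.
by rewrite w_moment eD ?eqxx.
Qed.

(** Both sides obey the same recursion on the factors.  The terms that
[coefficient] discards vanish in the sum: a factor that would raise an exponent
above D by [grid_sum_over], a variable retired too early by [grid_sum_low]. *)
Lemma grid_sum_coefficient x0 P (vs : seq V) (m : seq nat) e :
  uniq vs -> size m = size vs -> well_indexed (size vs) P ->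
  (forall i, (i < size vs)%N ->
     (e (nth x0 vs i) + nth 0 m i = D (nth x0 vs i))%N) ->
  (forall v, v \notin vs -> e v = D v) ->
  sumn m = size (op_edges x0 P vs) ->
  grid_sum (op_edges x0 P vs) e = coefficient P m.
Proof.
elim: P vs m e => [|[i j|i] P IH] vs m e uvs sm /=.
- move=> _ evs enot m0.
  have am : all (pred1 0%N) m.
    by elim: (m) m0 => //= a s IHs /eqP; rewrite addn_eq0 => /andP[-> /eqP].
  rewrite am; apply: grid_sum_exact => v.
  have [vin|] := boolP (v \in vs); last exact: enot.
  have := evs (index v vs); rewrite index_mem nth_index // => <- //.
  have := allP am (nth 0 m (index v vs)); rewrite mem_nth ?sm ?index_mem //.
  by move=> /(_ isT)/eqP ->; rewrite addn0.
- case/andP=> /andP[il jl] wP evs enot sumE.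
  have sumeD : (\sum_v e v + sumn m = \sum_v D v)%N.
    have -> : (sumn m = \sum_v nth 0 m (index v vs))%N.
      rewrite (bigID (mem vs)) /= [X in (_ + X)%N]big1 ?addn0; last first.
        move=> v vN; rewrite nth_default // sm memNindex //.
      rewrite -big_uniq //= (big_nth x0) big_mkord sumnE (big_nth 0%N) big_mkord sm.
      by apply: eq_bigr => l _; rewrite index_uniq.
    rewrite -big_split /=; apply: eq_bigr => v _.
    have [vin|vN] := boolP (v \in vs).
      by have := evs (index v vs); rewrite index_mem nth_index // => ->.
    by rewrite enot // nth_default ?addn0 // sm memNindex.
  have half l : (l < size vs)%N ->
      grid_sum (op_edges x0 P vs) (bump_at (nth x0 vs l) e) =
      if (0 < nth 0 m l)%N then coefficient P (decr l m) else 0.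
    move=> ls; case: ifP => [ml|].
      apply: IH => //; first by rewrite size_decr sm.
      + move=> q qs; rewrite nth_decr /bump_at nth_uniq //.
        by have := evs q qs; case: eqP => [->|_] /=; lia.
      + move=> v vN; rewrite /bump_at enot //.
        by case: eqP => // vE; rewrite vE mem_nth in vN.
      + by have := sumn_decr ml; lia.
    move=> /negbT; rewrite -leqNgt leqn0 => /eqP m0.
    apply: (@grid_sum_over (nth x0 vs l)).
      by rewrite sum_bump; move: sumE sumeD => /=; lia.
    by have := evs l ls; rewrite m0 addn0 /bump_at eqxx => ->; lia.
  by rewrite grid_sum_cons !half.
- case/andP=> il; rewrite -(size_remove il) => wP evs enot sumE.
  have pv := perm_remove x0 il.
  have /andP[xN ur] : (nth x0 vs i \notin remove i vs) && uniq (remove i vs).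
    by rewrite -cons_uniq -(perm_uniq pv).
  have rE q : (q < size (remove i vs))%N ->
     ((if (q < i)%N then q else q.+1) < size vs)%N.
    by rewrite size_remove //; case: (ltnP q i); lia.
  case: (nth 0%N m i =P 0%N) => [mi|/eqP mi].
    apply: IH => //; first by rewrite !size_remove ?sm.
    + by move=> q qs; rewrite !nth_remove ?sm //; apply: evs; apply: rE.
    + move=> v vN; have [vin|] := boolP (v \in vs); last exact: enot.
      move: vin; rewrite (perm_mem pv) inE (negPf vN) orbF => /eqP ->.
      by rewrite -[RHS]evs // mi addn0.
    + by rewrite sumn_remove.
  apply: (@grid_sum_low (nth x0 vs i)).
    by rewrite -[D _](evs i) //; lia.
  apply/allP => p /(op_edges_mem wP) /andP[p1 p2].
  by apply/andP; split; apply: contraNneq xN => <-.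
Qed.
End GridSum.

Lemma op_edges_map (T U : Type) (f : T -> U) x0 y0 P vs :
  well_indexed (size vs) P ->
  op_edges y0 P (map f vs) = [seq (f p.1, f p.2) | p <- op_edges x0 P vs].
Proof.
elim: P vs => [|[i j|i] P IH] vs //=.
  by case/andP=> /andP[il jl] wP; rewrite !(nth_map x0) // IH.
case/andP=> il; rewrite -(size_remove il) => /IH <-.
by rewrite /remove map_cat map_take map_drop.
Qed.

(** The Combinatorial Nullstellensatz for graph polynomials.  With colours
numbered and weights supported in the lists, the coefficient is a weighted sum
of values of the polynomial, so some list colouring gives a nonzero value; there
the two ends of each edge differ. *)
Theorem list_coloring_of_coefficient (C : eqType) (c0 : C) n P m
    (L : nat -> seq C) :
  size m = n -> well_indexed n P -> coefficient P m != 0%R ->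
  (forall i, i < n -> uniq (L i) && (nth 0 m i < size (L i))) ->
  exists phi : nat -> C, (forall i, i < n -> phi i \in L i) /\
    forall p, p \in op_edges 0 P (iota 0 n) -> phi p.1 != phi p.2.
Proof.
case: n => [|n] sm wP nz LP.
  exists (fun=> c0); split=> // p.
  by move/(@op_edges_mem _ 0 P [::] p wP).
(* A colour is represented by its position in [all]. *)
pose all := undup (flatten [seq L i | i <- iota 0 n.+1]).
pose N := size all.
have Lall i c : i < n.+1 -> c \in L i -> c \in all.
  move=> ilt cL; rewrite mem_undup; apply/flattenP; exists (L i) => //.
  by apply: map_f; rewrite mem_iota.
pose A (i : 'I_n.+1) := [set c : 'I_N | nth c0 all c \in L i].
have cardA (i : 'I_n.+1) : nth 0 m i < #|A i|.
  have /andP[uL /leq_trans] := LP i (ltn_ord i); apply.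
  rewrite cardE -(size_map (fun c : 'I_N => nth c0 all c)).
  apply: uniq_leq_size => // c cL.
  have cN : index c all < N by rewrite index_mem (Lall i).
  have cE : nth c0 all (Ordinal cN) = c by rewrite /= nth_index // (Lall i).
  by rewrite -cE; apply: map_f; rewrite mem_enum inE cE.
pose D (i : 'I_n.+1) := nth 0 m i.
have [w wP'] := fin_all_exists (fun i : 'I_n.+1 => lagrange_weights (cardA i)).
pose x0 := @ord0 n.
pose Es := op_edges x0 P (enum 'I_n.+1).
have sE : size (enum 'I_n.+1) = n.+1 by rewrite size_enum_ord.
have := @grid_sum_coefficient _ N w D (fun i => (wP' i).2) x0 P (enum 'I_n.+1) m
   (fun=> 0).
rewrite sE enum_uniq => /(_ isT sm wP) H.
have {}H : grid_sum w Es (fun=> 0) = coefficient P m.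
  apply: H.
  - by move=> i ilt; rewrite add0n /D nth_enum_ord.
  - by move=> v; rewrite mem_enum.
  - exact: coefficient_sumn.
have [f] : exists f : {ffun 'I_n.+1 -> 'I_N},
   (((\prod_v (w v (f v) * (f v : nat)%:R ^+ 0)) *
    \prod_(p <- Es) ((f p.1 : nat)%:R - (f p.2 : nat)%:R)) != 0)%R.
  apply/existsP; apply: contraNT nz => /existsPn no.
  by rewrite -H /grid_sum big1 // => f _; apply/eqP; have := no f; rewrite negbK.
rewrite mulf_eq0 negb_or => /andP[/prodf_neq0 fw fE].
exists (fun i => nth c0 all (f (inord i))); split.
  move=> i ilt; have := fw (inord i) isT; rewrite expr0 mulr1.
  by move/((wP' (inord i)).1); rewrite inE inordK.
have -> : iota 0 n.+1 = map val (enum 'I_n.+1) by rewrite val_enum_ord.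
rewrite (@op_edges_map _ _ _ x0) ?sE // => p /mapP[[x y] xyE ->] /=.
rewrite !inord_val nth_uniq ?undup_uniq //.
apply: contraNneq fE => fxy; rewrite (big_rem _ xyE) /= fxy subrr mul0r.
by [].
Qed.

(** * Computing coefficients *)

(** A formal combination of monomials.  The computations keep it sorted, so that
like terms meet when two combinations are merged. *)
Definition state := seq (seq nat * Z).

Fixpoint lex_compare (a b : seq nat) : comparison :=
  match a, b with
  | [::], [::] => Eq
  | [::], _ :: _ => Lt
  | _ :: _, [::] => Gt
  | x :: a', y :: b' =>
      if x < y then Lt else if y < x then Gt else lex_compare a' b'
  end.

Fixpoint merge_states (s : state) : state -> state :=
  fix merge_s (t : state) :=
    match s, t with
    | [::], _ => t
    | _, [::] => s
    | (a, x) :: s', (b, y) :: t' =>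
        match lex_compare a b with
        | Lt => (a, x) :: merge_states s' t
        | Gt => (b, y) :: merge_s t'
        | Eq => let z := Z.add x y in
            if Z.eqb z Z0 then merge_states s' t'
            else (a, z) :: merge_states s' t'
        end
    end.

Definition decr_state (i : nat) (st : state) : state :=
  [seq (decr i mz.1, mz.2) | mz <- st & 0 < nth 0 mz.1 i].

Definition opp_state (st : state) : state := [seq (mz.1, Z.opp mz.2) | mz <- st].

Definition exec_op (o : op) (st : state) : state :=
  match o with
  | Edge i j => merge_states (decr_state i st) (opp_state (decr_state j st))
  | Drop i => [seq (remove i mz.1, mz.2) | mz <- st & nth 0 mz.1 i == 0]
  end.

Definition exec (P : seq op) (st : state) : state := foldl (fun s o => exec_op o s) st P.

Definition sized (n : nat) (st : state) : bool :=
  all (fun mz => size mz.1 == n) st.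

Lemma decr_cat i m r : i < size m -> decr i (m ++ r) = decr i m ++ r.
Proof.
by elim: m i => [|a m IH] [|i] //= /IH {}IH; rewrite /decr /=; congr (_ :: _).
Qed.

Lemma remove_cat (T : Type) i (s r : seq T) : i < size s ->
  remove i (s ++ r) = remove i s ++ r.
Proof.
elim: s i => [|a s IH] [|i] //=; first by rewrite /remove /= !drop0.
by move=> /IH {}IH; rewrite /remove /=; congr (_ :: _).
Qed.

Lemma lex_compare_eq a b : lex_compare a b = Eq -> a = b.
Proof.
elim: a b => [|x a IH] [|y b] //=; case: ltnP => // yx; case: ltnP => // xy.
by move=> /IH ->; congr (_ :: _); apply/eqP; rewrite eqn_leq xy yx.
Qed.

Lemma sized_merge n s t : sized n s -> sized n t -> sized n (merge_states s t).
Proof.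
elim: s t => [|[a x] s IHs]; first by case.
elim=> [|[b y] t IHt] //= /andP[an sn] /andP[bn tn].
case: lex_compare => /=.
- by case: Z.eqb; rewrite /= ?an; apply: IHs.
- by rewrite an IHs //= bn.
- by rewrite bn IHt //= an.
Qed.

Lemma sized_exec_op n o st : op_indexed n o -> sized n st ->
  sized (op_size o n) (exec_op o st).
Proof.
have dec_sized i : i < n -> sized n st -> sized n (decr_state i st).
  move=> ilt sn; rewrite /sized all_map all_filter; apply: sub_all sn => mz /=.
  by move=> /eqP sz; apply/implyP=> _; rewrite size_decr ?sz.
case: o => [i j|i] /=.
  case/andP=> il jl sn; apply: sized_merge; first exact: dec_sized.
  by rewrite /sized all_map; apply: sub_all (dec_sized j jl sn) => -[].
move=> il; rewrite /sized all_map all_filter; apply: sub_all => mz /=.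
by move=> /eqP sz; apply/implyP=> _; rewrite size_remove sz.
Qed.

Section Value.
Local Open Scope ring_scope.

(** The exponents [rest] stay out of reach of the operations.  Keeping them apart
lets one computation serve products with arbitrarily many further variables. *)
Definition value (P : seq op) (rest : seq nat) (st : state) : rat :=
  \sum_(mz <- st) (int_of_Z mz.2)%:~R * coefficient P (mz.1 ++ rest).

Lemma value_merge P rest s t :
  value P rest (merge_states s t) = value P rest s + value P rest t.
Proof.
have nilE : value P rest [::] = 0 by rewrite /value big_nil.
have consE a x u : value P rest ((a, x) :: u) =
    (int_of_Z x)%:~R * coefficient P (a ++ rest) + value P rest u.
  by rewrite /value big_cons.
elim: s t => [|[a x] s IHs] t; first by case: t => *; rewrite nilE add0r.
elim: t => [|[b y] t IHt]; first by rewrite nilE addr0.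
rewrite [merge_states _ _]/=; case cmpE: (lex_compare a b).
- have <- := lex_compare_eq cmpE; rewrite !consE.
  rewrite addrACA -mulrDl -intrD -(rmorphD int_of_Z) -IHs.
  case: Z.eqb_spec => [xy0|_]; last by rewrite consE.
  have -> : x + y = 0 by exact: xy0.
  by rewrite rmorph0 mul0r add0r.
- by rewrite consE IHs addrA -consE.
- by rewrite consE IHt !consE addrCA.
Qed.

Lemma value_exec_op n o P rest st : op_indexed n o -> sized n st ->
  value (o :: P) rest st = value P rest (exec_op o st).
Proof.
have nth_front i m : size m = n -> (i < n)%N -> nth 0%N (m ++ rest) i = nth 0%N m i.
  by move=> sm il; rewrite nth_cat sm il.
have decrE i : (i < n)%N -> sized n st ->
    value P rest (decr_state i st) = \sum_(mz <- st) (int_of_Z mz.2)%:~R *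
      (if (0 < nth 0 (mz.1 ++ rest) i)%N
       then coefficient P (decr i (mz.1 ++ rest)) else 0).
  move=> il sn; rewrite /value big_map big_filter big_mkcond /=.
  apply: eq_big_seq => mz /(allP sn) /eqP sm; rewrite nth_front //.
  case: ifP => _; last by rewrite mulr0.
  by rewrite decr_cat ?sm.
case: o => [i j|i] /=.
  case/andP=> il jl sn; rewrite value_merge decrE //.
  have -> : value P rest (opp_state (decr_state j st)) =
      - value P rest (decr_state j st).
    rewrite /value big_map -sumrN; apply: eq_bigr => mz _ /=.
    by rewrite (rmorphN int_of_Z) mulrNz mulNr.
  rewrite decrE // -sumrB; apply: eq_bigr => mz _.
  by rewrite /= mulrBr.
move=> il sn; rewrite /value big_map big_filter [RHS]big_mkcond /=.
apply: eq_big_seq => mz /(allP sn) /eqP sm; rewrite nth_front //.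
case: ifP => _; last by rewrite mulr0.
by rewrite remove_cat ?sm.
Qed.

Definition exec_size (P : seq op) (n : nat) : nat := foldl (fun n o => op_size o n) n P.

Lemma value_exec n P Q rest st : well_indexed n P -> sized n st ->
  value (P ++ Q) rest st = value Q rest (exec P st).
Proof.
elim: P n st => [|o P IH] n st //= /andP[wo wP] sn.
rewrite (value_exec_op _ _ wo sn) (IH (op_size o n)) //.
exact: sized_exec_op.
Qed.

Lemma sized_exec n P st : well_indexed n P -> sized n st ->
  sized (exec_size P n) (exec P st).
Proof.
elim: P n st => [|o P IH] n st //= /andP[wo wP] sn.
by apply: IH => //; exact: sized_exec_op.
Qed.

Lemma well_indexed_cat n P Q :
  well_indexed n (P ++ Q) = well_indexed n P && well_indexed (exec_size P n) Q.
Proof.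
by elim: P n => [|o P IH] n //=; rewrite IH andbA.
Qed.

Definition nonzero_scalar (st : state) : bool :=
  if st is [:: (m, z)] then all (pred1 0%N) m && ~~ Z.eqb z Z0 else false.

Lemma nonzero_scalarP st : nonzero_scalar st -> value [::] [::] st != 0.
Proof.
case: st => [|[m z] [|]] //= /andP[m0 /negP z0].
rewrite /value big_seq1 cats0 /= m0 mulr1 intr_eq0.
apply: contra_not_neq z0 => z0; apply/Z.eqb_eq.
by rewrite -[z]int_of_ZK z0.
Qed.

Lemma coefficient_neq0 P m : well_indexed (size m) P ->
  nonzero_scalar (exec P [:: (m, Zpos xH)]) -> coefficient P m != 0.
Proof.
move=> wP /nonzero_scalarP.
rewrite -(@value_exec (size m)) //; last by rewrite /sized /= eqxx.
by rewrite cats0 /value big_seq1 cats0 mul1r.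
Qed.

End Value.

(** * A nonzero coefficient for every long cycle *)

(** The variables of a cycle come in blocks of two slots, first the spoke at a
vertex of the cycle, then the rim edge to the next vertex.  These are the
conflicts of the block at slots s and s + 1 with itself and with the two blocks
after it; a rim edge conflicts with the spoke and the rim edge two blocks later,
a spoke does not. *)
Definition block_edges (s : nat) : seq op :=
  [:: Edge s s.+1; Edge s s.+2; Edge s s.+3;
      Edge s.+1 s.+2; Edge s.+1 s.+3; Edge s.+1 s.+4; Edge s.+1 (s + 5)].

(** The first two blocks keep slots 0 to 3 throughout, since the last two blocks
meet them when the cycle closes up; the block being processed is at slots 4
and 5. *)
Definition block : seq op := block_edges 4 ++ [:: Drop 4; Drop 4].

(** The last two blocks, at slots 4 to 7, followed by the first two. *)
Definition closing : seq op :=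
  [:: Edge 4 5; Edge 4 6; Edge 4 7; Edge 5 6; Edge 5 7; Edge 5 0; Edge 5 1;
      Edge 6 7; Edge 6 0; Edge 6 1; Edge 7 0; Edge 7 1; Edge 7 2; Edge 7 3].

Definition chain (m : nat) : seq op := flatten (nseq m block).

Definition opening_edges : seq op := block_edges 0 ++ block_edges 2.

Definition cycle_program (k : nat) : seq op :=
  opening_edges ++ chain (k - 4) ++ closing.

Lemma well_indexed_chain m : well_indexed (8 + m.*2) (chain m ++ closing).
Proof. by elim: m => [|m IH] //=; rewrite !doubleS !addnS; exact: IH. Qed.

Lemma well_indexed_cycle_program k : 4 <= k ->
  well_indexed k.*2 (cycle_program k).
Proof.
move=> k4; have -> : k.*2 = 8 + (k - 4).*2 by lia.
by rewrite /cycle_program /=; exact: well_indexed_chain.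
Qed.

Definition append_slots (d : seq nat) (st : state) : state :=
  [seq (mz.1 ++ d, mz.2) | mz <- st].

Lemma value_append P d rest st :
  value P (d ++ rest) st = value P rest (append_slots d st).
Proof. by rewrite /value big_map; apply: eq_bigr => mz _; rewrite /= catA. Qed.

Lemma sized_append n d st : sized n st -> sized (n + size d) (append_slots d st).
Proof.
by rewrite /sized all_map; apply: sub_all => mz /= /eqP <-; rewrite size_cat.
Qed.

(** Exponents of two consecutive blocks.  Full degree means an average of
seven for each block; with these values the partial products become stationary. *)
Definition pattern : seq nat := [:: 3; 3; 3; 5].

Definition double_step (st : state) : state :=
  exec (block ++ block) (append_slots pattern st).

Lemma sized_double_step st : sized 8 st -> sized 8 (double_step st).
Proof. by move/(sized_append pattern); apply: sized_exec. Qed.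

(** One period of the pattern is consumed before the next is looked at. *)
Lemma value_double_steps r Q rest st : sized 8 st ->
  value (chain r.*2 ++ Q) (flatten (nseq r pattern) ++ rest) st =
  value Q rest (iter r double_step st).
Proof.
elim: r st => [|r IH] st s8 //.
have -> : chain r.+1.*2 ++ Q = (block ++ block) ++ (chain r.*2 ++ Q) by [].
have -> : flatten (nseq r.+1 pattern) ++ rest =
  pattern ++ (flatten (nseq r pattern) ++ rest) by [].
rewrite value_append (@value_exec 12) //; last exact: sized_append s8.
by rewrite IH ?iterSr //; exact: sized_double_step.
Qed.

Definition opening (u : seq nat) : state :=
  exec opening_edges [:: (u, Zpos xH)].

(** Exponents on the first four blocks, and on the last block when k is odd.
They are one choice within the bounds of [cycle_exponents_le] for which the
finitely many evaluations below succeed. *)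
Definition even_window : seq nat := [:: 2; 4; 3; 5; 2; 5; 3; 4].
Definition odd_window : seq nat := [:: 3; 5; 3; 2; 2; 5; 3; 5].
Definition odd_tail : seq nat := [:: 3; 4].

Definition even_state r := iter r double_step (opening even_window).
Definition odd_state r := iter r double_step (opening odd_window).

Lemma iter_fixed (T : Type) (f : T -> T) x n r :
  f (iter n f x) = iter n f x -> iter r f x = iter (minn r n) f x.
Proof.
move=> fix_n; case: (leqP r n) => // nr; rewrite -(subnK (ltnW nr)) iterD.
by elim: (r - n) => //= j ->.
Qed.

(** The partial products repeat from the third period on. *)
Lemma even_states_nonzero r : 0 < r -> nonzero_scalar (exec closing (even_state r)).
Proof.
move=> r0; rewrite /even_state (@iter_fixed _ _ _ 3); last first.
  by apply/eqP; vm_compute.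
have: minn r 3 \in [:: 1; 2; 3] by rewrite !inE; lia.
by rewrite !inE => /or3P[] /eqP ->; vm_compute.
Qed.

Lemma odd_states_nonzero r :
  nonzero_scalar (exec (block ++ closing) (append_slots odd_tail (odd_state r))).
Proof.
rewrite /odd_state (@iter_fixed _ _ _ 3); last by apply/eqP; vm_compute.
have: minn r 3 \in [:: 0; 1; 2; 3] by rewrite !inE; lia.
by rewrite !inE => /or4P[] /eqP ->; vm_compute.
Qed.

Definition cycle_exponents (k : nat) : seq nat :=
  if odd k then odd_window ++ flatten (nseq (k - 5)./2 pattern) ++ odd_tail
  else even_window ++ flatten (nseq (k - 4)./2 pattern).

Lemma coefficient_cycle k : 5 < k ->
  coefficient (cycle_program k) (cycle_exponents k) != 0%R.
Proof.
move=> k5; rewrite /cycle_program /cycle_exponents.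
have openE u Q rest : size u = 8 -> value (opening_edges ++ Q) rest [:: (u, Zpos xH)] =
    value Q rest (opening u).
  by move=> su; apply: (@value_exec 8 opening_edges Q); [|rewrite /sized /= su].
have size_open u : size u = 8 -> sized 8 (opening u).
  by move=> su; apply: (@sized_exec 8 opening_edges); [|rewrite /sized /= su].
have start u Q rest : coefficient (opening_edges ++ Q) (u ++ rest) =
    value (opening_edges ++ Q) rest [:: (u, Zpos xH)].
  by rewrite /value big_seq1 mul1r.
case: ifP => ok.
  have -> : k - 4 = ((k - 5)./2).*2 + 1 by lia.
  have -> Q : chain (((k - 5)./2).*2 + 1) ++ Q = chain ((k - 5)./2).*2 ++ (block ++ Q).
    by rewrite /chain nseqD flatten_cat -catA.
  rewrite start openE // value_double_steps ?size_open //.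
  rewrite -[odd_tail]cats0 value_append -[block ++ closing]cats0.
  rewrite (@value_exec 10); [|by []|].
    exact: nonzero_scalarP (odd_states_nonzero _).
  apply: (@sized_append 8); elim: (_./2) => [|r IH]; first exact: size_open.
  exact: sized_double_step.
have -> : k - 4 = ((k - 4)./2).*2 by lia.
rewrite doubleK start openE // -[flatten _]cats0 value_double_steps ?size_open //.
rewrite -[closing]cats0 (@value_exec 8); [|by []|].
  by apply/nonzero_scalarP/even_states_nonzero; lia.
elim: (_./2) => [|r IH]; first exact: size_open.
exact: sized_double_step.
Qed.

Lemma size_cycle_exponents k : 3 < k -> size (cycle_exponents k) = k.*2.
Proof.
have sz r : size (flatten (nseq r pattern)) = 4 * r.
  by elim: r => //= r ->; lia.
by rewrite /cycle_exponents; case: ifP; rewrite !size_cat sz /=; lia.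
Qed.

Lemma cycle_exponents_le k i : nth 0 (cycle_exponents k) i <= if odd i then 5 else 3.
Proof.
have cat_le s t : ~~ odd (size s) ->
    (forall i, nth 0 s i <= if odd i then 5 else 3) ->
    (forall i, nth 0 t i <= if odd i then 5 else 3) ->
    forall i, nth 0 (s ++ t) i <= if odd i then 5 else 3.
  move=> es sP tP j; rewrite nth_cat; case: ltnP => js //.
  by have := tP (j - size s); rewrite oddB // (negPf es) addbF.
have patP r : forall i, nth 0 (flatten (nseq r pattern)) i <= if odd i then 5 else 3.
  elim: r => [|r IH] j; first by rewrite nth_nil; case: odd.
  by apply: (cat_le) => //; do 5?[case=> //].
have even_pat r : ~~ odd (size (flatten (nseq r pattern))).
  by elim: r => //= r; rewrite !negbK.
rewrite /cycle_exponents; case: ifP => _; move: i; apply: (cat_le) => //.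
- by do 9?[case=> //].
- by apply: (cat_le) => //; do 3?[case=> //].
- by do 9?[case=> //].
Qed.

Definition block_pairs (i i1 i2 : nat) : seq (nat * nat) :=
  [:: (i.*2, i.*2.+1); (i.*2, i1.*2); (i.*2, i1.*2.+1);
      (i.*2.+1, i1.*2); (i.*2.+1, i1.*2.+1);
      (i.*2.+1, i2.*2); (i.*2.+1, i2.*2.+1)].

Definition chain_pairs (m j : nat) : seq (nat * nat) :=
  op_edges 0 (chain m ++ closing) ([:: 0; 1; 2; 3] ++ iota j.*2 (4 + m.*2)).

Lemma chain_pairsS m j :
  chain_pairs m.+1 j = block_pairs j j.+1 j.+2 ++ chain_pairs m j.+1.
Proof. by rewrite /chain_pairs /block_pairs !doubleS. Qed.

Lemma chain_pairs0 j : {subset block_pairs j j.+1 0 ++ block_pairs j.+1 0 1 <= chain_pairs 0 j}.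
Proof.
apply/allP; rewrite /chain_pairs /block_pairs !doubleS double0 addn0 /=.
by rewrite !inE !eqxx ?orbT.
Qed.

Lemma chain_pairs_inner m j i : j <= i < j + m ->
  {subset block_pairs i i.+1 i.+2 <= chain_pairs m j}.
Proof.
elim: m j => [|m IH] j; first by lia.
rewrite chain_pairsS => jim p pi; rewrite mem_cat; case: (eqVneq i j) => ij.
  by rewrite -ij pi.
by rewrite (IH j.+1) ?orbT //; lia.
Qed.

Lemma chain_pairs_last m j : {subset chain_pairs 0 (j + m) <= chain_pairs m j}.
Proof.
elim: m j => [|m IH] j p; first by rewrite addn0.
by rewrite chain_pairsS mem_cat addnS => /(IH j.+1) ->; rewrite orbT.
Qed.

Lemma cycle_program_pairs k i : 3 < k -> i < k ->
  {subset block_pairs i (i.+1 %% k) (i.+2 %% k) <=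
    op_edges 0 (cycle_program k) (iota 0 k.*2)}.
Proof.
move=> k3 ik p pi.
have kE : k.*2 = 8 + (k - 4).*2 by lia.
have -> : op_edges 0 (cycle_program k) (iota 0 k.*2) =
    block_pairs 0 1 2 ++ block_pairs 1 2 3 ++ chain_pairs (k - 4) 2.
  by rewrite kE.
rewrite !mem_cat.
case: (ltnP i.+2 k) => i2.
  move: pi; rewrite (modn_small (ltnW i2)) (modn_small i2) => pi.
  case: i ik i2 pi => [|[|i]] ik i2 pi; rewrite ?pi ?orbT //.
  by rewrite (@chain_pairs_inner _ _ i.+2) ?orbT //; lia.
have := @chain_pairs_last (k - 4) 2 p.
have -> : 2 + (k - 4) = k.-2 by lia.
move=> H; rewrite H ?orbT //; apply: chain_pairs0; rewrite mem_cat.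
case: k k3 ik pi i2 {kE H} => [|[|q]] // q2 iq pi qi.
have q1 : q.+1 < q.+2 by [].
move: pi; have [->|->] : i = q \/ i = q.+1 by lia.
  by rewrite modn_small // modnn => ->.
rewrite modnn -[q.+3]/(1 + q.+2) modnDr modn_small //.
by move=> ->; rewrite orbT.
Qed.

(** Even labels are spokes and odd labels rim edges. *)
Lemma cycle_list_coloring (C : eqType) (c0 : C) k (L : nat -> seq C) : 5 < k ->
  (forall t, t < k.*2 -> uniq (L t) && ((if odd t then 5 else 3) < size (L t))) ->
  exists phi : nat -> C, (forall t, t < k.*2 -> phi t \in L t) /\
    forall i p, i < k -> p \in block_pairs i (i.+1 %% k) (i.+2 %% k) ->
      phi p.1 != phi p.2.
Proof.
move=> k5 LP.
have k4 : 3 < k by lia.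
have sE := size_cycle_exponents k4.
have wP := well_indexed_cycle_program k4.
have [|phi [phiL phiP]] :=
    list_coloring_of_coefficient c0 (L := L) sE wP (coefficient_cycle k5).
  move=> t tk; have /andP[-> /=] := LP t tk; apply: leq_ltn_trans.
  exact: cycle_exponents_le.
exists phi; split=> // i p ik pi; apply: phiP.
exact: cycle_program_pairs pi.
Qed.

(** * Conflicts between edges *)

Section ConflictGraph.
Variable G : sgraph.
Implicit Types (x y z a b r v w : G) (A B : {set G}) (X Y S : {set {set G}}).

(** For two distinct edges, being at distance at most 2.  Edges are handled as
vertex sets, so that colourings and lists are total functions. *)
Definition near A B : bool :=
  (A != B) && [exists x in A, exists y in B, (x == y) || adj x y].

Lemma nearP A B : reflect (A <> B /\ exists x y, [/\ x \in A, y \in B & x = y \/ adj x y])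
  (near A B).
Proof.
apply: (iffP andP) => [[/eqP AB /existsP[x /andP[xA /existsP[y /andP[yB xy]]]]]|].
  by split=> //; exists x, y; split=> //; case/orP: xy => [/eqP|]; [left|right].
case=> /eqP AB [x [y [xA yB xy]]]; split=> //; apply/existsP; exists x.
rewrite xA /=; apply/existsP; exists y; rewrite yB.
by case: xy => ->; rewrite ?eqxx ?orbT.
Qed.

Lemma near_sym A B : near A B = near B A.
Proof.
suff half A' B' : near A' B' -> near B' A' by apply/idP/idP; exact: half.
case/nearP => XY [x [y [xX yY xy]]]; apply/nearP; split; first by move=> E; apply: XY.
by exists y, x; split=> //; case: xy => [->|]; [left | rewrite adj_sym; right].
Qed.

Lemma edgesP A : reflect (exists x y, adj x y /\ A = [set x; y]) (A \in edges G).
Proof.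
rewrite inE; apply: (iffP existsP) => [[x /existsP[y /andP[xy /eqP E]]]|].
  by exists x, y.
by case=> x [y [xy ->]]; exists x; apply/existsP; exists y; rewrite xy eqxx.
Qed.

Lemma adj_neq x y : adj x y -> x != y.
Proof. by move=> xy; apply/eqP => E; rewrite E adj_irrefl in xy. Qed.

Lemma edge_other A x : A \in edges G -> x \in A -> exists2 y, adj x y & A = [set x; y].
Proof.
case/edgesP => y [z [yz ->]]; rewrite !inE => /orP[]/eqP ->; first by exists z.
by exists y; [rewrite adj_sym | rewrite setUC].
Qed.

Lemma near_of_distance (e f : edge G) d : e <> f ->
  at_distance (G := line_graph G) d e f -> d <= 2 -> near (val e) (val f).
Proof.
move=> ef /andP[/existsP[p /andP[ep /eqP pf]] _] d2.
have vef : val e <> val f by move=> /val_inj.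
have meet (g h : edge G) : edge_adj g h -> exists2 x, x \in val g & x \in val h.
  by case/andP => _ /set0Pn[x]; rewrite inE => /andP[]; exists x.
case: d p ep pf d2 => [|[|[|d]]] p //.
- by rewrite (tuple0 p) /= => _ /ef.
- case/tupleP: p => g p; rewrite (tuple0 p) /= andbT => + gf _; rewrite gf.
  case/meet => x xe xf; apply/nearP; split=> //; exists x, x; split=> //; by left.
- case/tupleP: p => g p; case/tupleP: p => h p; rewrite (tuple0 p) /= andbT.
  case/andP => /meet[x xe xg] + hf _; rewrite hf => /meet[y yg yf].
  apply/nearP; split=> //; exists x, y; split=> //.
  have [z xz gE] := edge_other (valP g) xg.
  by move: yg; rewrite gE !inE => /orP[]/eqP ->; [left|right].
Qed.

Section Coloring.
Variable C : eqType.
Implicit Types L : {set G} -> seq C.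

Definition colorable L X : Prop := exists phi : {set G} -> C,
  (forall A, A \in X -> phi A \in L A) /\
  (forall A B, A \in X -> B \in X -> near A B -> phi A <> phi B).

(** Deleting the colours of the conflicting edges of X from the lists on S makes
every colouring of S compatible with the given colouring of X. *)
Lemma colorable_split L X S :
  (forall A, A \in S -> uniq (L A)) ->
  colorable L X ->
  (forall L', (forall A, A \in S -> uniq (L' A) /\
      size (L A) <= #|[set B in X | near A B]| + size (L' A)) -> colorable L' S) ->
  colorable L (X :|: S).
Proof.
move=> uL [phi [phiL phiP]] colS.
pose used A := [seq phi B | B <- enum [set B in X | near A B]].
pose L' A := [seq c <- L A | c \notin used A].
have [|psi [psiL psiP]] := colS L'.
  move=> A AS; split; first by rewrite filter_uniq ?uL.
  rewrite -(count_predC (mem (used A)) (L A)) -size_filter size_filter.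
  rewrite -[count (predC _) _]size_filter leq_add2r -size_filter.
  rewrite cardE -(size_map phi); apply: uniq_leq_size.
    by rewrite filter_uniq ?uL.
  by move=> c; rewrite mem_filter => /andP[].
have psi_new A B : A \in S -> B \in X -> near A B -> psi A <> phi B.
  move=> AS BX AB E; have := psiL A AS; rewrite mem_filter => /andP[/negP[]].
  by rewrite E; apply: map_f; rewrite mem_enum inE BX.
exists (fun A => if A \in S then psi A else phi A); split=> [A|A B].
  rewrite inE orbC; case: ifP => [AS _|_ /= /phiL //].
  by have := psiL A AS; rewrite mem_filter => /andP[].
rewrite !inE ![_ || (_ \in S)]orbC; case: ifP => AS; case: ifP => BS //= AX BX.
- exact: psiP.
- exact: psi_new.
- by rewrite near_sym => BA E; apply: (psi_new B A).
- exact: phiP.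
Qed.

Lemma colorable_add L X A : uniq (L A) ->
  #|[set B in X | near A B]| < size (L A) ->
  colorable L X -> colorable L (A |: X).
Proof.
move=> uL lt colX; rewrite setUC; apply: colorable_split => // [B|L' L'P].
  by rewrite inE => /eqP ->.
have [_ /(leq_trans lt)] := L'P A (set11 A).
case E: (L' A) => [|c s]; first by rewrite addn0 ltnn.
move=> _; exists (fun=> c); split=> [B|B B'].
  by rewrite inE => /eqP ->; rewrite E mem_head.
by rewrite !inE => /eqP -> /eqP ->; rewrite /near eqxx.
Qed.

End Coloring.

Definition touched X x : bool := [exists A in X, x \in A].

(** The edges with which an edge at a conflicts by way of its neighbour x, as
ordered pairs of vertices, called darts below. *)
Definition fan a x : {set G * G} := (a, x) |: [set (x, y) | y in [set y | adj x y] :\ a].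

(** The darts near the edge ab on the side of a, restricted to X.  Darts are
counted rather than edges: there are at most six on each side, and if short
cycles make two of them the same edge, the list of ab gains a colour. *)
Definition darts X a b : {set G * G} :=
  [set p in \bigcup_(x in [set x | adj a x] :\ b) fan a x | [set p.1; p.2] \in X].

Lemma near_darts X a b : adj a b -> X \subset edges G ->
  #|[set B in X | near [set a; b] B]| <= #|darts X a b| + #|darts X b a|.
Proof.
move=> ab /subsetP XE; apply: leq_trans (leq_card_setU _ _).
apply: leq_trans (leq_imset_card (fun p => [set p.1; p.2]) _).
apply/subset_leq_card/subsetP => B; rewrite inE => /andP[BX].
case/nearP => AB [x [c [xA cB xc]]].
have [d cd BE] := edge_other (XE B BX) cB.
suff [p pD pE] : exists2 p, p \in \bigcup_(z in [set z | adj a z] :\ b) fan a z :|: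
    \bigcup_(z in [set z | adj b z] :\ a) fan b z & B = [set p.1; p.2].
  by apply/imsetP; exists p => //; move: pD; rewrite !inE -pE BX !andbT.
have gen u v : adj u v -> [set u; v] <> B -> u = c \/ adj u c ->
  exists2 p, p \in \bigcup_(z in [set z | adj u z] :\ v) fan u z :|:
    \bigcup_(z in [set z | adj v z] :\ u) fan v z & B = [set p.1; p.2].
  move=> uv uvB uc.
  have first y s t : adj s y -> y != t ->
      (s, y) \in \bigcup_(z in [set z | adj s z] :\ t) fan s z.
    by move=> sy yt; apply/bigcupP; exists y; rewrite !inE ?eqxx ?yt.
  case: uc => [uc|uc].
    exists (u, d); last by rewrite uc.
    rewrite inE first ?uc //; apply/eqP => dv; apply: uvB; by rewrite BE uc dv.
  have [cv|cv] := eqVneq c v.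
    exists (v, d); last by rewrite -cv.
    rewrite inE orbC first -?cv //; apply/eqP => du; apply: uvB.
    by rewrite BE cv du setUC.
  have [du|du] := eqVneq d u.
    exists (u, c); last by rewrite BE du setUC.
    by rewrite inE first.
  exists (c, d) => //; rewrite inE; apply/orP; left; apply/bigcupP; exists c.
    by rewrite !inE cv.
  rewrite inE; apply/orP; right; apply/imsetP; exists d => //.
  by rewrite !inE du.
move: xA; rewrite !inE => /orP[]/eqP xE; rewrite xE in xc.
  by apply: gen => // E; apply: AB.
have [||p pD pE] := gen b a _ _ xc; first by rewrite adj_sym.
  by rewrite setUC => E; apply: AB.
by exists p => //; rewrite setUC.
Qed.

Lemma darts_disjoint X Y a b : [disjoint X & Y] -> 
  #|darts X a b| + #|darts Y a b| <= #|\bigcup_(x in [set x | adj a x] :\ b) fan a x|.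
Proof.
move=> dXY; rewrite -cardsUI.
have -> : darts X a b :&: darts Y a b = set0.
  apply/setP => p; rewrite !inE; case: (_ \in \bigcup_(_ in _) _) => //=.
  have [pX|//] := boolP (_ \in X); rewrite (disjointFr dXY pX) andbF //.
rewrite cards0 addn0; apply/subset_leq_card/subsetP => p.
by rewrite !inE => /orP[]/andP[].
Qed.

Hypothesis subcubicG : forall x, degree x <= 3.

Lemma card_fan a x : adj a x -> #|fan a x| <= 3.
Proof.
move=> ax; apply: leq_trans (subcubicG x); rewrite /degree.
apply: (leq_trans (leq_card_setU _ _)); rewrite cards1 (cardsD1 a) inE adj_sym ax.
by rewrite add1n ltnS leq_imset_card.
Qed.

Lemma card_bigcup_le (I : finType) (T : finType) (P : pred I) (F : I -> {set T}) n :
  (forall i, P i -> #|F i| <= n) -> #|\bigcup_(i | P i) F i| <= n * #|P|.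
Proof.
move=> Fn; apply: (@leq_trans (\sum_(i | P i) #|F i|)).
  elim/big_rec2: _ => [|i U m _ Um]; first by rewrite cards0.
  by apply: (leq_trans (leq_card_setU _ _)); rewrite leq_add2l.
apply: leq_trans (_ : \sum_(i | P i) n <= _); first exact: leq_sum.
by rewrite sum_nat_const mulnC; apply: leq_mul.
Qed.

Lemma card_others a b : adj a b -> #|[set x | adj a x & x != b]| = (degree a).-1.
Proof.
move=> ab; rewrite /degree (cardsD1 b [set y | adj a y]) inE ab /=.
by apply: eq_card => x; rewrite !inE andbC.
Qed.

Lemma card_darts X a b : #|darts X a b| <=
  3 * #|[set x | adj a x & x != b] :&: [set x | touched X x]|.
Proof.
apply: leq_trans (_ : #|\bigcup_(x | x \in [set x | adj a x & x != b] :&: [set x | touched X x]) fan a x| <= _).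
  apply/subset_leq_card/subsetP => p; rewrite inE => /andP[/bigcupP[x xa px] pX].
  apply/bigcupP; exists x => //; move: xa; rewrite !inE andbC => -> /=.
  apply/existsP; exists [set p.1; p.2]; rewrite pX !inE.
  by move: px; rewrite inE => /orP[|/imsetP[y _ ->]]; rewrite ?inE; [move/eqP ->|]; rewrite /= eqxx ?orbT.
apply: (@card_bigcup_le _ _ (fun x => x \in _ :&: _)) => x; rewrite !inE => /andP[/andP[ax _] _].
exact: card_fan.
Qed.

Lemma card_darts_untouched X a b : ~~ touched X a -> #|darts X a b| <=
  2 * #|[set x | adj a x & x != b] :&: [set x | touched X x]|.
Proof.
move=> aX.
apply: leq_trans (_ : #|\bigcup_(x | x \in [set x | adj a x & x != b] :&: [set x | touched X x])
   [set (x, y) | y in [set y | adj x y] :\ a]| <= _).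
  apply/subset_leq_card/subsetP => p; rewrite inE => /andP[/bigcupP[x xa px] pX].
  apply/bigcupP; exists x.
    move: xa; rewrite !inE andbC => -> /=.
    apply/existsP; exists [set p.1; p.2]; rewrite pX !inE.
    by move: px; rewrite inE => /orP[|/imsetP[y _ ->]]; rewrite ?inE; [move/eqP ->|]; rewrite /= eqxx ?orbT.
  move: px; rewrite inE => /orP[|//]; rewrite inE => /eqP pE; case/negP: aX.
  by apply/existsP; exists [set p.1; p.2]; rewrite pX pE !inE eqxx.
apply: (@card_bigcup_le _ _ (fun x => x \in _ :&: _)) => x; rewrite !inE => /andP[/andP[ax _] _].
apply: (leq_trans (leq_imset_card _ _)).
by have := subcubicG x; rewrite /degree (cardsD1 a) inE adj_sym ax.
Qed.

End ConflictGraph.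

(** * Greedy colouring of a component *)

Section Component.
Variable G : sgraph.
Hypothesis subcubicG : forall x : G, degree x <= 3.
Variables (C : eqType) (c0 : C) (r : G).
Implicit Types (x y a b v w : G) (A B : {set G}) (X Y S : {set {set G}}).
Implicit Types L : {set G} -> seq C.

Definition component : {set G} := [set x | connect (@adj G) r x].

Definition component_edges : {set {set G}} :=
  [set A in edges G | A \subset component].

Lemma component_adj x y : x \in component -> adj x y -> y \in component.
Proof. by rewrite !inE => rx xy; apply: connect_trans rx (connect1 xy). Qed.

Lemma component_connect v x : v \in component -> x \in component ->
  connect (@adj G) v x.
Proof.
rewrite !inE => rv rx; apply: connect_trans rx.
by rewrite (sym_connect_sym (@adj_sym G)).
Qed.

Lemma component_edgeP a b : adj a b -> a \in component ->
  [set a; b] \in component_edges.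
Proof.
move=> ab ra; rewrite inE; apply/andP; split; first by apply/edgesP; exists a, b.
apply/subsetP => x; rewrite in_set2 => /orP[]/eqP -> //; exact: component_adj ab.
Qed.

Lemma component_edges_sub X : X \subset component_edges -> X \subset edges G.
Proof. by move/subset_trans; apply; apply/subsetP => A; rewrite inE => /andP[]. Qed.

Lemma boundary_step (P : pred G) v x : connect (@adj G) v x -> ~~ P v -> P x ->
  exists w a, [/\ adj w a, ~~ P w & P a].
Proof.
case/connectP => p; elim: p v => [|y p IH] v /=; first by move=> _ -> /negP.
case/andP => vy yp xE nv Px; have [Py|ny] := boolP (P y); first by exists v, y.
exact: IH yp xE ny Px.
Qed.

Lemma touched_sub X Y x : X \subset Y -> touched X x -> touched Y x.
Proof.
move=> /subsetP XY /existsP[A /andP[AX xA]]; apply/existsP; exists A.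
by rewrite XY.
Qed.

(** Of the at most twelve darts around ab, three are absent: those of the fan of w
when X misses w, those of the missing neighbour when a has degree at most 2. *)
Lemma near_le9 X a b w : X \subset edges G -> adj a b ->
  (adj a w && (w != b) && ~~ touched X w) || (degree a <= 2) ->
  #|[set B in X | near [set a; b] B]| <= 9.
Proof.
move=> XE ab aw; apply: (leq_trans (near_darts ab XE)).
have small : #|[set x | adj a x & x != b] :&: [set x | touched X x]| <= 1.
  case/orP: aw => [/andP[/andP[aw wb] wX]|da]; last first.
    by apply: (leq_trans (subset_leq_card (subsetIl _ _))); rewrite card_others //; lia.
  have := card_others ab; have := subcubicG a.
  rewrite (cardsD1 w [set x | adj a x & x != b]) inE aw wb /=.
  set M := _ :\ w; suff: #|[set x | adj a x & x != b] :&: [set x | touched X x]| <= #|M| by lia.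
  apply/subset_leq_card/subsetP => x; rewrite !inE => /andP[-> xX]; rewrite andbT.
  by apply: contraNneq wX => <-.
have other : #|[set x | adj b x & x != a] :&: [set x | touched X x]| <= 2.
  apply: (leq_trans (subset_leq_card (subsetIl _ _))).
  by rewrite card_others 1?adj_sym //; have := subcubicG b; lia.
have := card_darts subcubicG X a b; have := card_darts subcubicG X b a; lia.
Qed.

(** Since X misses v, walking from v to X one meets an edge from a vertex w missed
by X to an end a of some edge ab of X.  That edge is coloured after the rest of
X: the edges at w do not compete with it. *)
Lemma colorable_away L X v :
  (forall A, A \in edges G -> uniq (L A) /\ 10 <= size (L A)) ->
  X \subset component_edges -> v \in component -> ~~ touched X v -> colorable L X.
Proof.
move=> LP; have [n] := ubnP #|X|; elim: n X => // n IH X Xn XK rv vX.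
have [->|/set0Pn[A AX]] := eqVneq X set0.
  by exists (fun=> c0); split=> [A|A B]; rewrite inE.
have AK := subsetP XK A AX.
have [x xA] : exists x, x \in A.
  move: AK; rewrite inE => /andP[/edgesP[x [y [_ ->]]] _].
  by exists x; rewrite !inE eqxx.
have rx : x \in component.
  by move: AK; rewrite inE => /andP[_ /subsetP]; apply.
have [|w [a [wa wX /existsP[B /andP[BX aB]]]]] :=
    boundary_step (component_connect rv rx) vX.
  by apply/existsP; exists A; rewrite AX.
have BE : B \in edges G by have := subsetP (component_edges_sub XK) B BX.
have [b ab BE'] := edge_other BE aB.
have XE : X = B |: (X :\ B) by rewrite setD1K.
have XBX : X :\ B \subset X by exact: subsetDl.
have [uL sL] := LP B BE.
rewrite XE; apply: colorable_add => //.
  apply: leq_ltn_trans sL; rewrite BE'; apply: (@near_le9 _ _ _ w) => //.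
    by apply: component_edges_sub; apply: subset_trans XK; rewrite -BE'.
  rewrite adj_sym wa /= -BE' (contra (touched_sub XBX)) // andbT.
  apply/orP; left; apply: contraNneq wX => ->; apply/existsP; exists B.
  by rewrite BX BE' !inE eqxx orbT.
apply: IH => //; last by apply: contra vX; exact: touched_sub.
  by move: Xn; rewrite (cardsD1 B) BX.
exact: subset_trans XBX XK.
Qed.

(** The edges at v are coloured last; each has at most nine conflicts. *)
Lemma colorable_deficient L v :
  (forall A, A \in edges G -> uniq (L A) /\ 10 <= size (L A)) ->
  v \in component -> degree v <= 2 -> colorable L component_edges.
Proof.
move=> LP rv dv.
have add S X : X \subset component_edges -> S \subset component_edges ->
    (forall A, A \in S -> v \in A) -> colorable L X -> colorable L (X :|: S).
  have [n] := ubnP #|S|; elim: n S => // n IH S Sn XK SK Sv colX.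
  have [->|/set0Pn[A AS]] := eqVneq S set0; first by rewrite setU0.
  have AE := subsetP (component_edges_sub SK) A AS.
  have SAS : S :\ A \subset S by exact: subsetDl.
  have [b vb AE'] := edge_other AE (Sv A AS); have [uL sL] := LP A AE.
  have -> : X :|: S = A |: (X :|: S :\ A).
    by rewrite -{1}(setD1K AS) setUCA.
  apply: colorable_add => //.
    apply: leq_ltn_trans sL; rewrite AE'; apply: (@near_le9 _ _ _ v) => //.
      apply: component_edges_sub; rewrite subUset XK -AE'.
      exact: subset_trans SAS SK.
    by rewrite dv orbT.
  apply: IH => //; last by move=> B /(subsetP SAS)/Sv.
    by move: Sn; rewrite (cardsD1 A) AS.
  exact: subset_trans SAS SK.
have -> : component_edges = [set A in component_edges | v \notin A]
    :|: [set A in component_edges | v \in A].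
  by apply/setP => A; rewrite !inE; case: (v \in A); rewrite ?andbT ?andbF ?orbF.
apply: add; try by apply/subsetP => A; rewrite inE => /andP[].
  by move=> A; rewrite inE => /andP[].
apply: (@colorable_away _ _ v) => //.
  by apply/subsetP => A; rewrite inE => /andP[].
by apply/existsP => -[A /andP[]]; rewrite inE => /andP[_ /negP].
Qed.

(** The edges outside S are coloured greedily towards v, and S is left to be
coloured from what remains of the lists. *)
Lemma colorable_from_root L S v :
  (forall A, A \in edges G -> uniq (L A) /\ 10 <= size (L A)) ->
  S \subset component_edges -> v \in component ->
  (forall x, adj v x -> [set v; x] \in S) ->
  (forall L', (forall A, A \in S -> uniq (L' A) /\
      10 <= #|[set B in component_edges :\: S | near A B]| + size (L' A)) ->
    colorable L' S) ->
  colorable L component_edges.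
Proof.
move=> LP SK rv vS colS.
have -> : component_edges = (component_edges :\: S) :|: S.
  by rewrite setUC -{1}(setID component_edges S) (setIidPr SK).
have SE := subsetP (component_edges_sub SK).
apply: colorable_split => [A /SE /LP[] //||L' L'P].
  apply: (@colorable_away _ _ v) => //; first exact: subsetDl.
  apply/existsP => -[A /andP[]]; rewrite inE => /andP[AS AK] vA.
  have [x vx AE] : exists2 x, adj v x & A = [set v; x].
    by apply: edge_other vA; move: AK; rewrite inE => /andP[].
  by rewrite AE vS in AS.
apply: colS => A AS; have [uL' sL'] := L'P A AS; split=> //.
by apply: leq_trans sL'; have [] := LP A (SE A AS).
Qed.

Lemma card_fans a b : adj a b ->
  #|\bigcup_(x in [set x | adj a x] :\ b) fan a x| <= 6.
Proof.
move=> ab; apply: (@leq_trans (3 * #|[set x | adj a x] :\ b|)).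
  apply: (@card_bigcup_le _ _ (fun x => x \in _ :\ _)) => x.
  by rewrite !inE => /andP[_]; exact: card_fan.
have := subcubicG a; rewrite /degree (cardsD1 b [set y | adj a y]) inE ab; lia.
Qed.

(** At most twelve darts surround ab, and those in S cost it no colour. *)
Lemma list_size_from_darts S (L' : {set G} -> seq C) a b : adj a b ->
  10 <= #|[set B in component_edges :\: S | near [set a; b] B]| +
        size (L' [set a; b]) ->
  #|darts S a b| + #|darts S b a| <= size (L' [set a; b]) + 2.
Proof.
move=> ab; have XE : component_edges :\: S \subset edges G.
  by apply: component_edges_sub; exact: subsetDl.
have dis : [disjoint component_edges :\: S & S].
  by rewrite -setI_eq0; apply/eqP/setP => A; rewrite !inE andbC; case: (A \in S).
have ba : adj b a by rewrite adj_sym.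
have := near_darts ab XE; have := darts_disjoint a b dis.
have := darts_disjoint b a dis; have := card_fans ab; have := card_fans ba; lia.
Qed.

End Component.

(** * Exploring a cubic graph *)

(** The explored part of a cubic graph: distinct vertices are labelled 0, 1, ...,
with their known neighbours and the pairs known not to be adjacent.  A label
with three known neighbours is closed. *)
Record config := Config {nbrs : seq (seq nat); nonadj : seq (nat * nat)}.

Definition num_labels c := size (nbrs c).
Definition nbr c a := nth [::] (nbrs c) a.
Definition is_open c a := size (nbr c a) < 3.

Definition add_edge c a b : config :=
  Config (mkseq (fun i => if i == a then rcons (nbr c a) b
                          else if i == b then rcons (nbr c b) a else nbr c i)
            (maxn (num_labels c) b.+1)) (nonadj c).

Definition forbid c a b : config := Config (nbrs c) ((a, b) :: nonadj c).

(** Depth-first search for a path from x to b with at most n steps that avoids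
[seen]. *)
Fixpoint linked c n (seen : seq nat) x b : bool :=
  if n is n'.+1 then
    has (fun y => (y \notin seen) && ((y == b) || linked c n' (y :: seen) y b))
      (nbr c x)
  else false.

(** An edge between two linked labels would close a cycle shorter than k. *)
Definition maybe_adj k c a b : bool :=
  [&& is_open c a, is_open c b, (a, b) \notin nonadj c, (b, a) \notin nonadj c &
      ~~ linked c (k - 2) [:: a] a b].

(** Undecided pairs count as conflicts, which only makes S harder to colour: list
sizes are estimated from known edges alone. *)
Definition maybe_near k c (e f : nat * nat) : bool :=
  has (fun a => has (fun b => [|| a == b, b \in nbr c a | maybe_adj k c a b])
         [:: f.1; f.2]) [:: e.1; e.2].

Definition listed (E : seq (nat * nat)) a b : bool :=
  ((a, b) \in E) || ((b, a) \in E).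

(** The darts of the fans of a, other than that of b, as far as they are known. *)
Definition walks c a b : seq (nat * nat) :=
  flatten [seq (a, x) :: [seq (x, y) | y <- nbr c x & y != a]
          | x <- nbr c a & x != b].

Definition walks_in c E a b : seq (nat * nat) :=
  [seq p <- walks c a b | listed E p.1 p.2].

(** Each label in turn is multiplied with the later ones and retired. *)
Fixpoint conflict_program (T : Type) (conf : rel T) (E : seq T) : seq op :=
  if E is e :: E' then
    [seq Edge 0 j.+1 | j <- iota 0 (size E') & nth false (map (conf e) E') j]
    ++ Drop 0 :: conflict_program conf E'
  else [::].

(** A leaf lists the edges of S, each as two labels and the exponent of its
variable.  [Decide a b] has a branch where a and b are adjacent and one where
they are not; [Fresh a] labels a further neighbour of a. *)
Inductive certificate :=
  | Leaf of seq (nat * nat * nat)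
  | Decide of nat & nat & certificate & certificate
  | Fresh of nat & certificate.

(** An exponent d needs a list of size d + 1, and a list has at least two colours
fewer than there are darts of S around its edge; hence the bound on d + 3.  The
closed label with all its edges in S is the root of the greedy colouring. *)
Definition leaf_ok k c (es : seq (nat * nat * nat)) : bool :=
  let E := [seq s.1 | s <- es] in
  [&& all (fun e => [&& e.1 < num_labels c, e.2 < num_labels c & e.2 \in nbr c e.1]) E,
      has (fun a => (size (nbr c a) == 3) && all (listed E a) (nbr c a))
        (iota 0 (num_labels c)),
      all (fun s => let: (a, b, d) := s in
        [&& uniq (walks_in c E a b), uniq (walks_in c E b a) &
            d + 3 <= size (walks_in c E a b) + size (walks_in c E b a)]) es &
      nonzero_scalar
        (exec (conflict_program (maybe_near k c) E) [:: ([seq s.2 | s <- es], Zpos xH)])].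

Fixpoint certified k c t : bool :=
  match t with
  | Leaf es => leaf_ok k c es
  | Decide a b yes no =>
      [&& a < num_labels c, b < num_labels c, a != b, b \notin nbr c a,
          certified k (add_edge c a b) yes & certified k (forbid c a b) no]
  | Fresh a t' =>
      [&& a < num_labels c, is_open c a,
          all (fun b => [|| b == a, b \in nbr c a | ~~ maybe_adj k c a b])
            (iota 0 (num_labels c))
        & certified k (add_edge c a (num_labels c)) t']
  end.

Lemma well_indexed_conflict_program (T : Type) (conf : rel T) E :
  well_indexed (size E) (conflict_program conf E).
Proof.
elim: E => //= e E IH; rewrite well_indexed_cat; apply/andP; split.
  have: all (fun j => j < size E) (iota 0 (size E)).
    by apply/allP => j; rewrite mem_iota.
  elim: (iota _ _) => //= j s IHs /andP[jE /IHs {}IHs]; case: ifP => //= _.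
  by rewrite ltnS jE.
set s := map _ _; have -> n : exec_size s n = n by rewrite /s; elim: filter.
by [].
Qed.

Lemma op_edges_cat (T : Type) (x0 : T) P Q vs :
  all (fun o => if o is Edge _ _ then true else false) P ->
  op_edges x0 (P ++ Q) vs = op_edges x0 P vs ++ op_edges x0 Q vs.
Proof. by elim: P => //= -[i j|i] P IH //= /IH ->. Qed.

Lemma conflict_program_edges (T : Type) (U : eqType) (conf : rel T) (t0 : T)
    (x0 : U) E (vs : seq U) i j : size vs = size E -> i < j < size E ->
  conf (nth t0 E i) (nth t0 E j) ->
  (nth x0 vs i, nth x0 vs j) \in op_edges x0 (conflict_program conf E) vs.
Proof.
elim: E vs i j => [|e E IH] vs i j; first by rewrite ltn0 andbF.
case: vs => [//|v vs] [sv] /=.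
rewrite op_edges_cat; last by rewrite all_map; apply/allP.
rewrite mem_cat; case: i j => [|i] [|j] //=.
  rewrite ltnS => jE cej; apply/orP; left.
  have: j \in [seq j <- iota 0 (size E) | nth false (map (conf e) E) j].
    by rewrite mem_filter mem_iota add0n jE (nth_map t0) // cej.
  elim: filter => //= l s IHs; rewrite !in_cons => /predU1P[<-|/IHs ->].
    by rewrite eqxx.
  by rewrite orbT.
rewrite !ltnS => ij cij; apply/orP; right.
have -> : remove 0 (v :: vs) = vs by rewrite /remove /= drop0.
exact: IH.
Qed.

Section Soundness.
Variable G : sgraph.
Hypothesis subcubicG : forall x : G, degree x <= 3.
Variables (C : eqType) (c0 : C) (r : G).
Hypothesis cubic : forall x, x \in component r -> degree x = 3.
Variable k : nat.
Hypothesis noshort : forall s : seq G, {subset s <= component r} ->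
  3 <= size s < k -> uniq s -> ~~ cycle (@adj G) s.

Record realizes (g : nat -> G) c : Prop := Realizes {
  real_inj : forall a b, a < num_labels c -> b < num_labels c -> g a = g b -> a = b;
  real_uniq : forall a, uniq (nbr c a);
  real_sym : forall a b, b \in nbr c a -> a \in nbr c b;
  real_lt : forall a b, b \in nbr c a -> b < num_labels c;
  real_adj : forall a b, b \in nbr c a -> adj (g a) (g b);
  real_nonadj_lt : forall a b, (a, b) \in nonadj c -> (a < num_labels c) && (b < num_labels c);
  real_nonadj : forall a b, (a, b) \in nonadj c -> ~~ adj (g a) (g b);
  real_in : forall a, a < num_labels c -> g a \in component r }.

Lemma nbr_lt c a b : b \in nbr c a -> a < num_labels c.
Proof. by rewrite ltnNge; apply: contraTN => ca; rewrite /nbr nth_default. Qed.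

Section Realized.
Variables (g : nat -> G) (c : config).
Hypothesis gc : realizes g c.

Lemma map_nbr_uniq a : uniq (map g (nbr c a)).
Proof.
rewrite map_inj_in_uniq; first exact: real_uniq gc a.
by move=> x y /(real_lt gc) xc /(real_lt gc) yc; exact: real_inj gc _ _ xc yc.
Qed.

Lemma nbr_closed a y : a < num_labels c -> ~~ is_open c a -> adj (g a) y ->
  exists2 b, b \in nbr c a & y = g b.
Proof.
rewrite /is_open -leqNgt => ac na ay.
have sub : {subset map g (nbr c a) <= enum [set y | adj (g a) y]}.
  by move=> z /mapP[b bc ->]; rewrite mem_enum inE (real_adj gc).
have card3 : size (enum [set y | adj (g a) y]) = 3.
  by rewrite -cardE; exact: cubic (real_in gc ac).
have [|_ E] := uniq_min_size (map_nbr_uniq a) sub; first by rewrite card3 size_map.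
by apply/mapP; rewrite E mem_enum inE.
Qed.

Lemma linked_path n seen x b : linked c n seen x b ->
  exists p, [/\ path (fun a b => b \in nbr c a) x p, last x p = b, uniq p,
    all (fun y => y \notin seen) p & 0 < size p <= n].
Proof.
elim: n seen x => //= n IH seen x /hasP[y yx /andP[ys /orP[/eqP yb|]]].
  by exists [:: y]; rewrite /= yx ys.
case/IH => p [yp lp up ps /andP[p0 pn]]; exists (y :: p); split=> //=.
- by rewrite yx.
- rewrite up andbT; apply/negP => /(allP ps); by rewrite mem_head.
- rewrite ys; apply: sub_all ps => z; rewrite inE negb_or; by case/andP.
Qed.

(** A closed label has no unknown neighbour, and a path of at most k - 2 known
edges together with the edge joining its ends is a cycle shorter than k. *)
Lemma maybe_adjP a b : a < num_labels c -> b < num_labels c -> adj (g a) (g b) ->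
  (b \in nbr c a) || maybe_adj k c a b.
Proof.
move=> ac bc ab; have [//|nab /=] := boolP (b \in nbr c a).
have oa : is_open c a.
  apply/negPn/negP => na; have [b' b'a E] := nbr_closed ac na ab.
  by case/negP: nab; rewrite (real_inj gc bc (real_lt gc b'a) E).
have ob : is_open c b.
  apply/negPn/negP => nb; have ba : adj (g b) (g a) by rewrite adj_sym.
  have [a' a'b E] := nbr_closed bc nb ba.
  case/negP: nab; apply: (real_sym gc).
  by rewrite (real_inj gc ac (real_lt gc a'b) E).
apply/and5P; split=> //.
- by apply: contraL ab; exact: (real_nonadj gc).
- by rewrite adj_sym in ab; apply: contraL ab; exact: (real_nonadj gc).
apply/negP => /linked_path[p [ap lp up pa /andP[p0 pk]]].
have plt : {in a :: p, forall x, x < num_labels c}.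
  move=> x; rewrite inE => /predU1P[-> //|]; elim: p (a) ap {lp up pa p0 pk} => //= y p IH z.
  case/andP=> zy yp; rewrite inE => /predU1P[->|]; [exact: (real_lt gc zy) | exact: IH yp].
have ua : uniq (a :: p).
  rewrite /= up andbT; apply/negP => /(allP pa); by rewrite mem_head.
have sz : 1 < size p.
  case: p {up pa pk plt ua} p0 ap lp => [|y [|z p]] //= _ /andP[ay _] yb.
  by rewrite -yb ay in nab.
have /negP[] : ~~ cycle (@adj G) (map g (a :: p)).
  apply: noshort.
  - by move=> x /mapP[y /plt yc ->]; exact: (real_in gc).
  - by rewrite size_map /=; lia.
  - rewrite map_inj_in_uniq // => x y xp yp; apply: (real_inj gc); exact: plt.
rewrite /= rcons_path last_map lp adj_sym ab andbT path_map.
by apply: sub_path ap => x y; exact: (real_adj gc).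
Qed.

Lemma maybe_nearP e f : e.1 < num_labels c -> e.2 < num_labels c -> f.1 < num_labels c ->
  f.2 < num_labels c -> near [set g e.1; g e.2] [set g f.1; g f.2] -> maybe_near k c e f.
Proof.
move=> e1 e2 f1 f2 /nearP[_ [x [y [xe yf xy]]]].
have [a [ae ac xE]] : exists a, [/\ a \in [:: e.1; e.2], a < num_labels c & x = g a].
  move: xe; rewrite in_set2 => /orP[]/eqP ->; [exists e.1 | exists e.2];
  by rewrite !inE eqxx ?orbT.
have [b [bf bc yE]] : exists b, [/\ b \in [:: f.1; f.2], b < num_labels c & y = g b].
  move: yf; rewrite in_set2 => /orP[]/eqP ->; [exists f.1 | exists f.2];
  by rewrite !inE eqxx ?orbT.
apply/hasP; exists a => //; apply/hasP; exists b => //; subst x y.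
by case: xy => [/(real_inj gc ac bc) -> | /(maybe_adjP ac bc) ->]; rewrite ?eqxx ?orbT.
Qed.

Definition image_edge (e : nat * nat) : {set G} := [set g e.1; g e.2].

Lemma card_walks_in E a b : a < num_labels c -> b < num_labels c ->
  {subset [seq [set g e.1; g e.2] | e <- E] <= edges G} ->
  uniq (walks_in c E a b) ->
  size (walks_in c E a b) <=
    #|darts [set A in [seq image_edge e | e <- E]] (g a) (g b)|.
Proof.
move=> ac bc EG uw; rewrite cardE -(size_map (fun p => (g p.1, g p.2))).
have walkP p : p \in walks_in c E a b -> [/\ listed E p.1 p.2, p.1 < num_labels c,
   p.2 < num_labels c & exists2 x, x \in nbr c a & (x != b) /\
   (p = (a, x) \/ p.1 = x /\ p.2 \in nbr c x /\ p.2 != a)].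
  rewrite mem_filter => /andP[pE /flattenP[s /mapP[x]]].
  rewrite mem_filter => /andP[xb xa] ->; rewrite inE => /predU1P[pE'|].
    rewrite pE' in pE *; split=> //; first exact: (real_lt gc xa).
    by exists x => //; split=> //; left.
  case/mapP => y; rewrite mem_filter => /andP[ya yx] pE'; rewrite pE' in pE *.
  split=> //; [exact: (real_lt gc xa) | exact: (real_lt gc yx) |].
  by exists x => //; split=> //; right.
apply: uniq_leq_size.
  rewrite map_inj_in_uniq // => -[x y] [x' y'] /walkP[_ /= xc yc _] /walkP[_ /= xc' yc' _].
  by case=> /(real_inj gc xc xc') -> /(real_inj gc yc yc') ->.
move=> q /mapP[p /walkP[pE p1 p2 [x xa [xb pP]]] ->]; rewrite mem_enum inE.
have gxb : g x != g b.
  apply: contraNneq xb => /(real_inj gc (real_lt gc xa) bc) ->; exact: eqxx.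
apply/andP; split; last first.
  rewrite inE; apply/mapP; case/orP: pE => pE; first by exists (p.1, p.2).
  by exists (p.2, p.1) => //; rewrite /image_edge setUC.
apply/bigcupP; exists (g x); first by rewrite !inE gxb (real_adj gc).
rewrite inE; case: pP => [-> | [<- [p2x p2a]]]; first by rewrite inE eqxx.
apply/orP; right; apply/imsetP; exists (g p.2) => //; rewrite !inE (real_adj gc) // andbT.
by apply: contraNneq p2a => /(real_inj gc p2 ac) ->.
Qed.

Lemma leaf_sound es L : leaf_ok k c es ->
  (forall A, A \in edges G -> uniq (L A) /\ 10 <= size (L A)) ->
  colorable (C := C) L (component_edges r).
Proof.
rewrite /leaf_ok; set E := map _ es => /and4P[/allP Eok /hasP[v vc /andP[/eqP v3 vE]] esok nz] LP.
have {}vc : v < num_labels c by move: vc; rewrite mem_iota.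
pose S := [set A in [seq image_edge e | e <- E]].
have EG : {subset [seq image_edge e | e <- E] <= component_edges r}.
  move=> A /mapP[e /Eok /and3P[e1 e2 ee] ->].
  by apply: component_edgeP; [exact: (real_adj gc) | exact: (real_in gc)].
have EG' : {subset [seq [set g e.1; g e.2] | e <- E] <= edges G}.
  by move=> A /EG; rewrite inE => /andP[].
apply: (@colorable_from_root _ subcubicG _ c0 r _ S (g v)) => //.
- by apply/subsetP => A; rewrite inE; exact: EG.
- exact: (real_in gc).
- move=> x vx; have [|b bv ->] := nbr_closed vc _ vx; first by rewrite /is_open v3.
  rewrite inE; apply/mapP; case/orP: (allP vE b bv) => bE; first by exists (v, b).
  by exists (b, v) => //; rewrite /image_edge setUC.
move=> L' L'P; pose e0 : nat * nat := (0, 0).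
pose P := conflict_program (maybe_near k c) E.
pose D := [seq s.2 | s <- es].
have sD : size D = size E by rewrite !size_map.
have wP : well_indexed (size E) P by exact: well_indexed_conflict_program.
have nzP : coefficient P D != 0%R by apply: coefficient_neq0; rewrite ?sD.
have [|phi [phiL phiP]] := list_coloring_of_coefficient c0
    (L := fun i => L' (image_edge (nth e0 E i))) sD wP nzP.
  move=> i iE; have ies : i < size es by move: iE; rewrite size_map.
  have AS : image_edge (nth e0 E i) \in S by rewrite inE map_f ?mem_nth.
  have [-> /= sL'] := L'P _ AS.
  have := allP esok (nth (e0, 0) es i); rewrite mem_nth // => /(_ isT).
  move: sL' (Eok _ (mem_nth e0 iE)).
  rewrite /D (nth_map (e0, 0)) // /E (nth_map (e0, 0)) // -/E.
  case: (nth _ es i) => [[a b] d] /= sL' /and3P[ac bc ba] /and3P[u1 u2 dle].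
  have := list_size_from_darts subcubicG (real_adj gc ba) sL'.
  have := card_walks_in ac bc EG' u1; have := card_walks_in bc ac EG' u2.
  rewrite -/S /image_edge /=; move: dle {L'P LP}; clear; lia.
pose lab A := index A [seq image_edge e | e <- E].
have labP A : A \in S -> lab A < size E /\ image_edge (nth e0 E (lab A)) = A.
  rewrite inE => AE; have lA : lab A < size E by rewrite -(size_map image_edge) index_mem.
  by split=> //; rewrite -(nth_map e0 set0) // nth_index.
exists (fun A => phi (lab A)); split=> [A /labP[lA {2}<-]|A B /labP[lA AE] /labP[lB BE] nAB].
  exact: phiL.
have lt_neq i j : i < j < size E ->
    near (image_edge (nth e0 E i)) (image_edge (nth e0 E j)) -> phi i != phi j.
  move=> ij nij; have := phiP (i, j); apply.
  have iE : i < size E by lia.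
  have jE : j < size E by lia.
  have /and3P[i1 i2 _] := Eok _ (mem_nth e0 iE).
  have /and3P[j1 j2 _] := Eok _ (mem_nth e0 jE).
  have := @conflict_program_edges _ _ (maybe_near k c) e0 0 E (iota 0 (size E)) i j.
  rewrite size_iota !nth_iota ?add0n //; apply=> //.
  exact: maybe_nearP.
apply/eqP; case: (ltngtP (lab A) (lab B)) => lAB.
- by apply: lt_neq; rewrite ?AE ?BE ?lAB.
- by rewrite eq_sym; apply: lt_neq; rewrite ?AE ?BE ?lAB // near_sym.
- by case/nearP: nAB => []; rewrite -AE lAB BE.
Qed.

End Realized.

Lemma nbr_add_edge c a b i : a < num_labels c -> b <= num_labels c ->
  nbr (add_edge c a b) i =
  if i == a then rcons (nbr c a) b
  else if i == b then rcons (nbr c b) a else nbr c i.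
Proof.
move=> ac bc; rewrite {1}/nbr /add_edge /=.
case: (ltnP i (maxn (num_labels c) b.+1)) => il; first by rewrite nth_mkseq.
rewrite nth_default ?size_mkseq //.
have ic : num_labels c <= i by lia.
by rewrite !ifN ?/nbr ?nth_default //; apply/eqP; lia.
Qed.

Lemma realizes_add_edge g g' c a b : realizes g c ->
  (forall i, i < num_labels c -> g' i = g i) -> a < num_labels c -> b <= num_labels c ->
  a != b -> b \notin nbr c a -> adj (g' a) (g' b) ->
  (forall i, i < num_labels c -> i != b -> g' i <> g' b) ->
  realizes g' (add_edge c a b).
Proof.
move=> gc g'E ac bc ab nab gab g'b.
have oE : num_labels (add_edge c a b) = maxn (num_labels c) b.+1 by rewrite /num_labels size_mkseq.
have nE := nbr_add_edge _ ac bc.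
have nba : a \notin nbr c b by apply: contra nab; exact: (real_sym gc).
have nbrP i j : j \in nbr (add_edge c a b) i ->
    [\/ i = a /\ j = b, i = b /\ j = a | j \in nbr c i].
  rewrite nE; case: eqP => [->|_]; first by rewrite mem_rcons inE => /predU1P[->|]; [constructor 1|constructor 3].
  by case: eqP => [->|_]; rewrite ?mem_rcons ?inE; [move=> /predU1P[->|]; [constructor 2|constructor 3] | constructor 3].
have nbr_old i j : j \in nbr c i -> j \in nbr (add_edge c a b) i.
  move=> ji; rewrite nE; case: eqP => [ia|_].
    by rewrite mem_rcons inE -ia ji orbT.
  by case: eqP => [ib|//]; rewrite mem_rcons inE -ib ji orbT.
split.
- move=> i j; rewrite oE => il jl.
  have [iE|ib] := eqVneq i b; have [jE|jb] := eqVneq j b; subst.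
  + by [].
  + by move/esym/g'b; case=> //; lia.
  + by move/g'b; case=> //; lia.
  + rewrite !g'E; try lia; apply: (real_inj gc); lia.
- move=> i; rewrite nE; case: eqP => [_|_]; last case: eqP => [_|_].
  + by rewrite rcons_uniq nab (real_uniq gc).
  + by rewrite rcons_uniq nba (real_uniq gc).
  + exact: (real_uniq gc).
- move=> i j /nbrP[[-> ->]|[-> ->]|/(real_sym gc)/nbr_old //]; rewrite nE.
  + by rewrite eq_sym (negPf ab) eqxx mem_rcons mem_head.
  + by rewrite eqxx mem_rcons mem_head.
- move=> i j /nbrP[[_ ->]|[_ ->]|/(real_lt gc)]; rewrite oE; lia.
- move=> i j /nbrP[[-> ->] //|[-> ->]|ji]; first by rewrite adj_sym.
  rewrite !g'E ?(real_adj gc) //; first exact: (real_lt gc ji).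
  exact: nbr_lt ji.
- move=> i j /(real_nonadj_lt gc)/andP[ic jc]; rewrite oE; lia.
- move=> i j ij; have /andP[ic jc] := real_nonadj_lt gc ij.
  by rewrite !g'E //; exact: (real_nonadj gc).
- move=> i; rewrite oE => il; have [->|ib] := eqVneq i b.
    by apply: component_adj gab; rewrite g'E //; exact: (real_in gc).
  rewrite g'E; first apply: (real_in gc); lia.
Qed.

(** At [Fresh a] the vertex labelled a has a neighbour beyond the known ones, and
no present label can be that neighbour. *)
Theorem certified_sound t c g L : realizes g c -> certified k c t ->
  (forall A, A \in edges G -> uniq (L A) /\ 10 <= size (L A)) ->
  colorable (C := C) L (component_edges r).
Proof.
move=> + + LP; elim: t c g => [es|a b yes IHyes no IHno|a t IH] c g gc /=.
- by move=> ok; exact: leaf_sound gc _ _ ok LP.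
- case/and5P=> ac bc ab nab /andP[cyes cno].
  have [gab|gab] := boolP (adj (g a) (g b)).
    apply: IHyes cyes; apply: (realizes_add_edge gc) => //; first exact: ltnW.
    by move=> i ic ib /(real_inj gc ic bc) E; rewrite E eqxx in ib.
  apply: (IHno _ g _ cno); case: (gc) => gi gu gs gl ga gnl gn gr; split=> //= i j.
  + by rewrite in_cons => /predU1P[[-> ->]|/gnl //]; apply/andP.
  + by rewrite in_cons => /predU1P[[-> ->] //|/gn].
- case/and4P=> ac oa /allP old ct.
  have [y gay yN] : exists2 y, adj (g a) y & y \notin map g (nbr c a).
    have := cubic (real_in gc ac); rewrite /degree => d3.
    have [y] : exists y, y \in [set y | adj (g a) y] :\: [set y in map g (nbr c a)].
      apply/set0Pn; rewrite -card_gt0 cardsD subn_gt0.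
      apply: (@leq_ltn_trans #|[set y in map g (nbr c a)]|).
        exact: subset_leq_card (subsetIr _ _).
      rewrite cardsE; apply: leq_ltn_trans (card_size _) _.
      by rewrite size_map d3.
    by rewrite !inE => /andP[yN gay]; exists y.
  have yg b : b < num_labels c -> y <> g b.
    move=> bc yE; have := old b; rewrite mem_iota bc => /(_ isT) /or3P[/eqP ba|ba|].
    - by move: gay; rewrite yE ba adj_irrefl.
    - by case/negP: yN; rewrite yE map_f.
    have ba : b \notin nbr c a by apply: contra yN => ba; rewrite yE map_f.
    by rewrite yE in gay; have := maybe_adjP gc ac bc gay; rewrite (negPf ba) /= => ->.
  pose g' i := if i == num_labels c then y else g i.
  have g'E i : i < num_labels c -> g' i = g i by rewrite /g'; case: eqP => // ->; rewrite ltnn.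
  apply: (IH _ g') ct; apply: (realizes_add_edge gc) => //.
  + by apply/eqP; lia.
  + by apply/negP => /(real_lt gc); rewrite ltnn.
  + by rewrite g'E // /g' eqxx.
  + by move=> i ic _; rewrite g'E // /g' eqxx => /esym/(yg _ ic).
Qed.

End Soundness.

(** * Certificates for cycles of length at most six *)

Definition cycle_config (k : nat) : config :=
  Config (mkseq (fun i => [:: i.+1 %% k; (i + k).-1 %% k]) k) [::].

(** For each length, S and the exponents at the leaves are the outcome of a search
among the sets of edges near the cycle. *)
Definition triangle_certificate : certificate :=
  (Fresh 0
  (Decide 1 3
   (Decide 2 3
    (Leaf [:: (0, 2, 5); (1, 2, 4); (2, 3, 2); (1, 3, 3); (0, 1, 1); (0, 3, 0)])
    (Fresh 2
    (Leaf [:: (0, 2, 5); (0, 1, 4); (1, 2, 3); (0, 3, 0); (1, 3, 1); (2, 4, 2)])))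
   (Fresh 1
   (Decide 2 3
    (Leaf [:: (0, 2, 0); (0, 1, 5); (0, 3, 2); (2, 3, 4); (1, 4, 1); (1, 2, 3)])
    (Decide 2 4
     (Leaf [:: (2, 4, 5); (0, 3, 3); (0, 2, 4); (0, 1, 2); (1, 4, 1); (1, 2, 0)])
     (Fresh 2
     (Leaf [:: (0, 2, 1); (1, 4, 3); (2, 5, 2); (1, 2, 5); (0, 1, 4); (0, 3, 0)]))))))).

Definition square_certificate : certificate :=
  (Fresh 0
  (Fresh 1
  (Decide 2 4
   (Decide 3 5
    (Leaf [:: (1, 2, 7); (0, 1, 6); (3, 5, 1); (2, 3, 5); (2, 4, 4); (0, 3, 2); (0, 4, 0); (1, 5, 3)])
    (Fresh 3
    (Decide 4 5
     (Leaf [:: (3, 6, 1); (1, 5, 0); (0, 4, 7); (1, 2, 6); (0, 1, 5); (0, 3, 4); (2, 3, 2); (2, 4, 3)])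
     (Decide 4 6
      (Leaf [:: (2, 3, 0); (0, 4, 7); (3, 6, 5); (0, 3, 4); (1, 5, 3); (2, 4, 2); (1, 2, 6); (0, 1, 1)])
      (Fresh 4
      (Decide 5 6
       (Decide 5 7
        (Leaf [:: (3, 6, 3); (0, 3, 4); (0, 1, 6); (2, 4, 5); (1, 2, 3); (0, 4, 1); (4, 7, 3); (2, 3, 2)])
        (Leaf [:: (4, 7, 3); (0, 3, 6); (1, 2, 5); (2, 4, 4); (2, 3, 2); (0, 4, 3); (1, 5, 3); (0, 1, 1)]))
       (Leaf [:: (1, 5, 3); (2, 4, 6); (0, 1, 5); (0, 4, 4); (0, 3, 3); (2, 3, 1); (1, 2, 2); (3, 6, 3)])))))))
   (Fresh 2
   (Decide 3 5
    (Decide 4 5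
     (Leaf [:: (2, 6, 0); (0, 3, 1); (3, 5, 7); (0, 4, 5); (2, 3, 3); (1, 2, 6); (0, 1, 4); (1, 5, 2)])
     (Decide 4 6
      (Fresh 4
      (Leaf [:: (4, 7, 2); (2, 6, 0); (1, 5, 6); (1, 2, 7); (4, 6, 4); (0, 3, 8); (3, 5, 3); (0, 1, 7); (0, 4, 2); (2, 3, 4)]))
      (Leaf [:: (0, 4, 3); (1, 2, 6); (3, 5, 5); (0, 3, 4); (0, 1, 3); (2, 3, 2); (1, 5, 1); (2, 6, 3)])))
    (Fresh 3
    (Decide 4 5
     (Decide 4 6
      (Leaf [:: (2, 3, 6); (1, 2, 7); (0, 4, 6); (0, 1, 8); (4, 6, 5); (1, 5, 4); (0, 3, 2); (2, 6, 1); (4, 5, 5); (3, 7, 0)])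
      (Decide 4 7
       (Leaf [:: (0, 4, 5); (2, 3, 1); (2, 6, 3); (1, 5, 4); (1, 2, 3); (3, 7, 1); (0, 1, 4); (0, 3, 5)])
       (Fresh 4
       (Leaf [:: (4, 8, 1); (4, 5, 4); (2, 6, 3); (0, 4, 6); (1, 5, 6); (1, 2, 6); (3, 7, 3); (0, 3, 7); (2, 3, 3); (0, 1, 2)]))))
     (Decide 4 6
      (Decide 4 7
       (Leaf [:: (1, 2, 6); (0, 3, 8); (3, 7, 6); (0, 4, 5); (2, 6, 4); (4, 6, 1); (4, 7, 5); (0, 1, 7); (2, 3, 2); (1, 5, 0)])
       (Fresh 4
       (Decide 5 6
        (Leaf [:: (1, 2, 6); (2, 3, 5); (2, 6, 7); (0, 4, 5); (1, 5, 2); (3, 7, 3); (4, 8, 2); (0, 3, 3); (4, 6, 5); (0, 1, 4)])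
        (Decide 5 7
         (Leaf [:: (1, 2, 6); (2, 3, 4); (0, 1, 7); (0, 3, 2); (0, 4, 6); (4, 6, 4); (3, 7, 3); (2, 6, 4); (4, 8, 2); (1, 5, 4)])
         (Decide 5 8
          (Leaf [:: (4, 6, 4); (3, 7, 3); (2, 3, 6); (0, 3, 7); (1, 5, 4); (2, 6, 6); (0, 4, 2); (4, 8, 3); (1, 2, 3); (0, 1, 3)])
          (Leaf [:: (4, 8, 2); (3, 7, 3); (4, 6, 4); (2, 3, 6); (1, 5, 3); (1, 2, 5); (0, 1, 7); (0, 3, 2); (0, 4, 5); (2, 6, 3)]))))))
      (Decide 4 7
       (Fresh 4
       (Leaf [:: (4, 8, 0); (4, 7, 2); (2, 6, 3); (3, 7, 6); (0, 4, 6); (0, 1, 7); (0, 3, 8); (1, 5, 3); (2, 3, 3); (1, 2, 3)]))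
       (Fresh 4
       (Fresh 4
       (Decide 5 6
        (Decide 5 7
         (Leaf [:: (5, 6, 5); (5, 7, 5); (2, 6, 6); (1, 5, 7); (0, 1, 5); (0, 3, 6); (1, 2, 3); (3, 7, 2); (0, 4, 1); (2, 3, 1)])
         (Leaf [:: (3, 7, 3); (0, 1, 5); (0, 4, 3); (0, 3, 3); (1, 5, 4); (2, 6, 4); (2, 3, 4); (1, 2, 0)]))
        (Decide 5 7
         (Decide 5 8
          (Leaf [:: (2, 3, 6); (0, 3, 5); (1, 2, 7); (0, 1, 5); (1, 5, 4); (2, 6, 3); (5, 8, 3); (3, 7, 2); (5, 7, 2); (0, 4, 4)])
          (Decide 5 9
           (Leaf [:: (5, 7, 4); (2, 6, 3); (0, 3, 5); (2, 3, 6); (3, 7, 5); (1, 5, 1); (1, 2, 3); (0, 4, 4); (5, 9, 3); (0, 1, 7)])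
           (Fresh 5
           (Leaf [:: (0, 4, 3); (0, 3, 5); (2, 3, 6); (1, 5, 5); (5, 7, 4); (5, 10, 2); (3, 7, 4); (0, 1, 7); (2, 6, 2); (1, 2, 2)]))))
         (Leaf [:: (2, 6, 3); (2, 3, 5); (1, 2, 4); (0, 3, 3); (0, 4, 3); (0, 1, 2); (3, 7, 3); (1, 5, 3)])))))))))))))).

Definition pentagon_certificate : certificate :=
  (Fresh 0
  (Fresh 1
  (Fresh 2
  (Fresh 3
  (Fresh 4
  (Decide 5 7
   (Leaf [:: (0, 5, 4); (0, 4, 4); (4, 9, 3); (1, 6, 3); (1, 2, 5); (3, 8, 3); (2, 3, 4); (2, 7, 4); (3, 4, 5); (0, 1, 5)])
   (Leaf [:: (2, 7, 3); (2, 3, 5); (1, 6, 3); (0, 1, 5); (4, 9, 3); (0, 4, 4); (3, 4, 5); (1, 2, 5); (3, 8, 3); (0, 5, 3)]))))))).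

Definition hexagon_certificate : certificate :=
  (Fresh 0
  (Fresh 1
  (Fresh 2
  (Fresh 3
  (Fresh 4
  (Fresh 5
  (Leaf [:: (1, 7, 3); (1, 2, 5); (3, 9, 2); (2, 3, 5); (3, 4, 5); (2, 8, 3); (4, 10, 1); (0, 5, 5); (0, 1, 5); (4, 5, 5); (0, 6, 3); (5, 11, 3)]))))))).

Lemma triangle_certified : certified 3 (cycle_config 3) triangle_certificate.
Proof. by vm_compute. Qed.

Lemma square_certified : certified 4 (cycle_config 4) square_certificate.
Proof. by vm_compute. Qed.

Lemma pentagon_certified : certified 5 (cycle_config 5) pentagon_certificate.
Proof. by vm_compute. Qed.

Lemma hexagon_certified : certified 6 (cycle_config 6) hexagon_certificate.
Proof. by vm_compute. Qed.

(** * Shortest cycles *)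

Section Cycles.
Variable G : sgraph.
Variables (r : G).
Hypothesis cubic : forall x, x \in component r -> degree x = 3.

Definition cycle_in (s : seq G) : bool :=
  [&& all (mem (component r)) s, 2 < size s, uniq s & cycle (@adj G) s].

(** A path is extended at its front as long as possible.  When this stops, all
neighbours of the front vertex lie on the path, and one of them that is not the
second vertex closes a cycle. *)
Lemma exists_cycle : exists s, cycle_in s.
Proof.
suff grow n : (exists s, cycle_in s) \/ exists x p, [/\ all (mem (component r)) (x :: p),
    path (@adj G) x p, uniq (x :: p) & size p = n].
  have [//|[x [p [_ _ /card_uniqP xp sp]]]] := grow #|G|.
  by have := max_card (mem (x :: p)); rewrite xp /= sp ltnn.
elim: n => [|n [?|[x [p [cxp xp ux sp]]]]]; [|by left|].
  by right; exists r, [::]; split; rewrite //= andbT inE.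
have cx : x \in component r by case/andP: cxp.
have d3 := cubic cx; rewrite /degree in d3.
have [/existsP[z /andP[xz zN]]|/existsPn old] :=
    boolP [exists z, adj x z && (z \notin x :: p)].
  right; exists z, (x :: p); split=> //=; last by rewrite sp.
  - by rewrite (component_adj cx xz).
  - by rewrite adj_sym xz.
  - by rewrite zN.
left; have old' z : adj x z -> z \in p.
  move=> xz; have := old z; rewrite xz negbK inE => /predU1P[zx|//].
  by rewrite zx adj_irrefl in xz.
(* Avoiding the second vertex of the path makes the cycle longer than 2. *)
have [z] : exists z, z \in [set z | adj x z] :\ head x p.
  apply/set0Pn; rewrite -card_gt0 (cardsD1 (head x p)) in d3 *.
  by move: d3; case: (_ \in _) => /=; lia.
rewrite !inE => /andP[zh xz]; have zp := old' z xz.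
have iz : 0 < index z p by case: (p) zh zp => //= y q; rewrite eq_sym => /negPf ->.
exists (x :: take (index z p).+1 p); apply/and4P; split.
- apply/allP => y; rewrite inE => /predU1P[-> //|/mem_take yp].
  by apply: (allP cxp); rewrite inE yp orbT.
- by rewrite /= size_takel ?index_mem.
- move: ux; rewrite /= => /andP[xN up]; rewrite take_uniq // andbT.
  by apply: contra xN; exact: mem_take.
rewrite /= rcons_path take_path //=.
rewrite (take_nth z) ?index_mem // last_rcons nth_index // adj_sym.
exact: xz.
Qed.

Lemma cycle_nth s i : cycle (@adj G) s -> i < size s ->
  adj (nth r s i) (nth r s (i.+1 %% size s)).
Proof.
case: s => // x s /= /(pathP r) cs il.
have := cs i; rewrite size_rcons => /(_ il); rewrite -rcons_cons !nth_rcons il.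
have [is_|si] := ltnP i (size s); first by rewrite modn_small.
have -> : i = size s by apply/eqP; rewrite eqn_leq si andbT -ltnS.
by rewrite eqxx modnn.
Qed.

(** The arc of the cycle from position i to position j, closed up by a detour
outside the cycle. *)
Lemma segment_cycle s i j q : cycle_in s -> i < j < size s ->
  all (fun y => (y \in component r) && (y \notin s)) q -> uniq q ->
  path (@adj G) (nth r s j) (rcons q (nth r s i)) -> 2 < j - i + 1 + size q ->
  exists2 t, cycle_in t & size t = j - i + 1 + size q.
Proof.
case/and4P => sK _ us cs /andP[ij js] qP uq pq sz.
pose seg := drop i (take j.+1 s).
have sseg : size seg = j - i + 1 by rewrite size_drop size_takel //; lia.
have segs : {subset seg <= s} by move=> y /mem_drop/mem_take.
have nseg l : l < j - i + 1 -> nth r seg l = nth r s (i + l).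
  by move=> ll; rewrite nth_drop nth_take //; lia.
exists (seg ++ q); last by rewrite size_cat sseg.
apply/and4P; split.
- rewrite all_cat; apply/andP; split; first by apply/allP => y /segs /(allP sK).
  by apply: sub_all qP => y /andP[].
- by rewrite size_cat sseg.
- rewrite cat_uniq uq andbT drop_uniq ?take_uniq //=.
  by apply/hasPn => y /(allP qP)/andP[_]; apply: contra; exact: segs.
have : sorted (@adj G) seg.
  apply/drop_sorted/take_sorted; case: (s) cs => //= x s'.
  by rewrite rcons_path => /andP[].
have := nseg 0; have := nseg (j - i); rewrite addn0 (subnKC (ltnW ij)).
case: (seg) sseg => [|a seg']; first by move=> /=; lia.
move=> /= [ssz] lst fst psg; rewrite rcons_cat cat_path psg /=.
have -> : last a seg' = nth r s j.
  by rewrite (last_nth r) -lst; [congr nth; lia | lia].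
by have /= -> := fst _; [|lia].
Qed.

Section LongCycle.
Hypothesis subcubicG : forall x : G, degree x <= 3.
Variable s : seq G.
Hypotheses (s_cycle : cycle_in s) (s_long : 6 < size s).
Hypothesis s_min : forall t, cycle_in t -> size s <= size t.
Notation k := (size s).
Notation v := (nth r s).

Definition next_index i := if i.+1 == k then 0 else i.+1.

Lemma modn_next i : i < k -> i.+1 %% k = next_index i.
Proof.
rewrite /next_index; case: eqP => [->|ne] ik; first by rewrite modnn.
by rewrite modn_small //; lia.
Qed.

Lemma next_lt i : i < k -> next_index i < k.
Proof. by rewrite /next_index; case: eqP; lia. Qed.

Lemma modn_next2 i : i < k -> i.+2 %% k = next_index (next_index i).
Proof.
move=> ik; rewrite -(modn_next (next_lt ik)) -(modn_next ik).
by rewrite -[in RHS]addn1 modnDml addn1.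
Qed.

Lemma v_in i : i < k -> v i \in component r.
Proof. by move=> ik; case/and4P: s_cycle => /allP sK _ _ _; apply/sK/mem_nth. Qed.

Lemma v_inj i j : i < k -> j < k -> v i = v j -> i = j.
Proof.
move=> ik jk /eqP; case/and4P: s_cycle => _ _ us _.
by rewrite nth_uniq // => /eqP.
Qed.

Lemma adj_next i : i < k -> adj (v i) (v (next_index i)).
Proof.
by move=> ik; rewrite -modn_next //; apply: cycle_nth => //; case/and4P: s_cycle.
Qed.

(** A chord together with an arc would be a shorter cycle. *)
Lemma chordless i j : i < k -> j < k -> adj (v i) (v j) ->
  j = next_index i \/ i = next_index j.
Proof.
have half a b : a < b < k -> adj (v a) (v b) -> b = next_index a \/ a = next_index b.
  move=> ab vab; case: (ltnP 2 (b - a + 1 + 0)) => big; last first.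
    by rewrite /next_index; do 2?[case: eqP]; lia.
  have [|||t tc st] := segment_cycle s_cycle ab (q := [::]) _ _ _ big => //.
    by rewrite /= adj_sym vab.
  by have := s_min tc; rewrite st /= /next_index; do 2?[case: eqP]; lia.
move=> ik jk vij; case: (ltngtP i j) => ij.
- by apply: half; rewrite ?ij.
- by rewrite adj_sym in vij; case: (half j i); rewrite ?ij //; [right|left].
- by rewrite ij adj_irrefl in vij.
Qed.

(** A detour with at most two inner vertices closes up both arcs between v i and
v j.  By minimality each arc has length at least k - 3, against k > 6. *)
Lemma no_detour i j q : i < k -> j < k -> i != j ->
  all (fun y => (y \in component r) && (y \notin s)) q -> uniq q ->
  0 < size q <= 2 -> ~~ path (@adj G) (v j) (rcons q (v i)).
Proof.
wlog ij : i j q / i < j => [wl ik jk ne qK uq sq|].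
  have [ij|ij] : i < j \/ j < i by lia.
    exact: wl.
  have := wl j i (rev q) ij jk ik; rewrite all_rev rev_uniq size_rev.
  move=> /(_ _ qK uq sq) H.
  have {}H := H (negbT (ltn_eqF ij)); apply: contra H => pq.
  have := rev_path (@adj G) (v j) (rcons q (v i)).
  rewrite last_rcons belast_rcons rev_cons => ->.
  by rewrite (eq_path (e' := @adj G)) // => x y; exact: adj_sym.
move=> ik jk _ qK uq /andP[q0 q2]; apply/negP => pq.
have ijk : i < j < k by rewrite ij.
have ij_sz : 2 < j - i + 1 + size q by lia.
have [t tc st] := segment_cycle s_cycle ijk qK uq pq ij_sz.
have inner := s_min tc; rewrite st in inner.
(* Rotating the cycle to start at v j makes the other arc a segment. *)
have rot_c : cycle_in (rot j s).
  case/and4P: s_cycle => sK s2 us cs; apply/and4P; split.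
  - by apply/allP => y; rewrite mem_rot; exact: (allP sK).
  - by rewrite size_rot.
  - by rewrite rot_uniq.
  - by rewrite rot_cycle.
have rot0 : nth r (rot j s) 0 = v j.
  by rewrite /rot nth_cat size_drop subn_gt0 jk nth_drop addn0.
have roti : nth r (rot j s) (k - j + i) = v i.
  by rewrite /rot nth_cat size_drop ifF; [rewrite nth_take; [congr nth; lia|lia]|lia].
have [|||||t' tc' st'] := segment_cycle rot_c (i := 0) (j := k - j + i) (q := rev q).
- by rewrite size_rot; lia.
- by rewrite all_rev; apply: sub_all qK => y; rewrite mem_rot.
- by rewrite rev_uniq.
- rewrite rot0 roti; have := rev_path (@adj G) (v j) (rcons q (v i)).
  rewrite last_rcons belast_rcons rev_cons => ->.
  by rewrite (eq_path (e' := @adj G)) // => x y; exact: adj_sym.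
- by rewrite size_rev; lia.
have := s_min tc'; rewrite st' size_rev; lia.
Qed.

Lemma common_outside i j y : i < k -> j < k -> y \in component r -> y \notin s ->
  adj (v i) y -> adj (v j) y -> i = j.
Proof.
move=> ik jk yK ys iy jy; apply/eqP/negPn/negP => ij.
have := @no_detour i j [:: y] ik jk ij; rewrite /= yK ys jy adj_sym iy.
by move=> /(_ isT isT isT).
Qed.

Lemma linked_outside i j y z : i < k -> j < k -> y \in component r -> y \notin s ->
  z \in component r -> z \notin s -> adj (v i) y -> adj (v j) z -> adj y z -> i = j.
Proof.
move=> ik jk yK ys zK zs iy jz yz; apply/eqP/negPn/negP => ij.
have := @no_detour i j [:: z; y] ik jk ij.
rewrite /= yK ys jz zK zs inE eq_sym (negPf (adj_neq yz)) ![adj _ (v i)]adj_sym iy.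
by rewrite [adj z y]adj_sym yz => /(_ isT isT isT).
Qed.

Definition spoke i : G := odflt (v i) [pick y in [set y | adj (v i) y & y \notin s]].

(** The two neighbours of v i along the cycle are its only neighbours on the
cycle, because the cycle has no chord. *)
Lemma spokeP i : i < k -> [/\ adj (v i) (spoke i), spoke i \notin s &
  forall y, adj (v i) y -> y \notin s -> y = spoke i].
Proof.
move=> ik; pose a := v (next_index i).
(* The predecessor of i on the cycle. *)
pose i' := if i is i'.+1 then i' else k.-1; pose b := v i'.
have i'k : i' < k by rewrite /i'; case: (i) ik => //; lia.
have i'E : next_index i' = i.
  by rewrite /next_index /i'; case: (i) ik => [|j] ik; case: eqP; lia.
have va : adj (v i) a by exact: adj_next.
have vb : adj (v i) b by rewrite adj_sym; have := adj_next i'k; rewrite i'E.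
have ab : a != b.
  apply/eqP => /(v_inj (next_lt ik) i'k); rewrite /next_index /i'.
  by case: (i) ik => [|j] ik; case: eqP; lia.
have NE : [set y | adj (v i) y & y \notin s] = [set y | adj (v i) y] :\ a :\ b.
  apply/setP => y; rewrite !inE; have [vy|] := boolP (adj (v i) y); last by rewrite !andbF.
  rewrite !andbT /=; have [ys|ys] := boolP (y \in s) => /=.
    apply/esym/negbTE; rewrite negb_and !negbK.
    move: ys vy => /(nthP r)[j jk <-] vij.
    case: (chordless ik jk vij) => [->|iE]; first by rewrite eqxx orbT.
    have -> : j = i'; last by rewrite eqxx.
    by move: iE; rewrite /next_index /i'; case: (i) ik => [|l] ik; case: eqP; lia.
  have nth_s l : l < k -> y != v l.
    by move=> lk; apply: contraNneq ys => ->; exact: mem_nth.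
  by rewrite !nth_s ?next_lt.
have card1 : #|[set y | adj (v i) y & y \notin s]| = 1.
  have := cubic (v_in ik); rewrite NE /degree.
  rewrite (cardsD1 a [set y | adj (v i) y]) (cardsD1 b (_ :\ a)) !inE va vb.
  by rewrite eq_sym ab /=; lia.
have /cards1P[u uE] : #|[set y | adj (v i) y & y \notin s]| == 1 by rewrite card1.
have spE : spoke i = u.
  rewrite /spoke uE; case: pickP => [y|]; first by rewrite inE => /eqP.
  by move/(_ u); rewrite inE eqxx.
have : u \in [set y | adj (v i) y & y \notin s] by rewrite uE set11.
rewrite inE spE => /andP[vu us]; split=> // y vy ys.
by apply/set1P; rewrite -uE inE vy.
Qed.

(** The numbering of spokes and rim edges by even and odd labels that the
polynomial uses. *)
Definition cycle_edge t : {set G} :=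
  if odd t then [set v t./2; v (next_index t./2)] else [set v t./2; spoke t./2].

(** Outer ends of different spokes are neither equal nor adjacent, since either
would be a detour; so spokes conflict through the cycle only. *)
Lemma near_spokes i j : i < k -> j < k -> i != j ->
  near [set v i; spoke i] [set v j; spoke j] -> j = next_index i \/ i = next_index j.
Proof.
move=> ik jk ij /nearP[_ [x [y [xe yf xy]]]].
have [vi si _] := spokeP ik; have [vj sj _] := spokeP jk.
have sK l : l < k -> adj (v l) (spoke l) -> spoke l \in component r.
  by move=> lk vl; exact: component_adj (v_in lk) vl.
have s_in l : l < k -> v l \in s by exact: mem_nth.
have ne E : i = j -> E by move=> eq_ij; rewrite eq_ij eqxx in ij.
move: xe yf; rewrite !in_set2 => /orP[]/eqP xE /orP[]/eqP yE; subst x y; case: xy => xy.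
- by apply: ne; exact: v_inj.
- exact: chordless.
- by case/negP: sj; rewrite -xy s_in.
- by apply: ne; exact: common_outside (sK j jk vj) sj xy vj.
- by case/negP: si; rewrite xy s_in.
- by apply: ne; rewrite adj_sym in xy; exact: common_outside (sK i ik vi) si vi xy.
- by apply: ne; rewrite -xy in vj; exact: common_outside (sK i ik vi) si vi vj.
- by apply: ne; exact: linked_outside (sK i ik vi) si (sK j jk vj) sj vi vj xy.
Qed.

Lemma near_spoke_rim i j : i < k -> j < k ->
  near [set v i; spoke i] [set v j; v (next_index j)] ->
  exists2 l, l = j \/ l = next_index j & [\/ l = i, l = next_index i | i = next_index l].
Proof.
move=> ik jk /nearP[_ [x [y [xe yf xy]]]].
have [vi si _] := spokeP ik.
have sK : spoke i \in component r by exact: component_adj (v_in ik) vi.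
have [l [lk lj yE]] : exists l, [/\ l < k, l = j \/ l = next_index j & y = v l].
  move: yf; rewrite in_set2 => /orP[]/eqP ->; first by exists j; split=> //; left.
  by exists (next_index j); split=> //; [exact: next_lt | right].
exists l => //; subst y.
move: xe; rewrite in_set2 => /orP[]/eqP xE; subst x; case: xy => xy.
- by constructor 1; apply: v_inj.
- by case: (chordless ik lk xy); [constructor 2 | constructor 3].
- by case/negP: si; rewrite xy mem_nth.
- by constructor 1; apply: common_outside sK si _ vi => //; rewrite adj_sym.
Qed.

Lemma near_rims i j : i < k -> j < k ->
  near [set v i; v (next_index i)] [set v j; v (next_index j)] ->
  exists a b, [/\ a = i \/ a = next_index i, b = j \/ b = next_index j &
    [\/ a = b, b = next_index a | a = next_index b]].
Proof.
move=> ik jk /nearP[_ [x [y [xe yf xy]]]].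
have idx l z : l < k -> z \in [set v l; v (next_index l)] ->
    exists a, [/\ a < k, a = l \/ a = next_index l & z = v a].
  move=> lk; rewrite in_set2 => /orP[]/eqP ->; first by exists l; split=> //; left.
  by exists (next_index l); split=> //; [exact: next_lt | right].
have [a [ak ai xE]] := idx i x ik xe; have [b [bk bj yE]] := idx j y jk yf.
exists a, b; split=> //; subst x y; case: xy => [/(v_inj ak bk)|/(chordless ak bk)].
  by constructor 1.
by case; [constructor 2 | constructor 3].
Qed.

Lemma next_inj i j : i < k -> j < k -> next_index i = next_index j -> i = j.
Proof. by rewrite /next_index; do 2?[case: eqP]; lia. Qed.

Lemma cycle_edge_even i : cycle_edge i.*2 = [set v i; spoke i].
Proof. by rewrite /cycle_edge odd_double doubleK. Qed.

Lemma cycle_edge_odd i : cycle_edge i.*2.+1 = [set v i; v (next_index i)].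
Proof. by rewrite /cycle_edge /= odd_double /= uphalf_double. Qed.

Definition same_block t u : bool :=
  has (fun i => (t, u) \in block_pairs i (i.+1 %% k) (i.+2 %% k)) (iota 0 k).

Lemma same_blockP i t u : i < k ->
  (t, u) \in block_pairs i (next_index i) (next_index (next_index i)) ->
  same_block t u.
Proof.
move=> ik tu; apply/hasP; exists i; first by rewrite mem_iota.
by rewrite modn_next // modn_next2.
Qed.

Lemma near_cycle_edges t u : t < k.*2 -> u < k.*2 ->
  near (cycle_edge t) (cycle_edge u) -> same_block t u || same_block u t.
Proof.
have blk i : i < k -> {subset block_pairs i (next_index i) (next_index (next_index i))
    <= fun p => same_block p.1 p.2}.
  by move=> ik [x y]; exact: same_blockP.
have spoke_rim i j : i < k -> j < k ->
    near [set v i; spoke i] [set v j; v (next_index j)] ->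
    same_block i.*2 j.*2.+1 || same_block j.*2.+1 i.*2.
  move=> ik jk /(near_spoke_rim ik jk)[l lj li].
  have [E|E|E|E] : [\/ j = i, j = next_index i, i = next_index j |
      i = next_index (next_index j)].
  - case: lj li => -> [E|E|E].
    + by constructor 1.
    + by constructor 2.
    + by constructor 3.
    + by constructor 3.
    + by constructor 1; exact: next_inj E.
    + by constructor 4.
  - by rewrite (same_blockP ik) // E /block_pairs !inE !eqxx.
  - by rewrite (same_blockP ik) // -E /block_pairs !inE !eqxx ?orbT.
  - by rewrite orbC (same_blockP jk) // -E /block_pairs !inE !eqxx ?orbT.
  - by rewrite orbC (same_blockP jk) // -E /block_pairs !inE !eqxx ?orbT.
have half q : q < k.*2 -> exists2 i, i < k & q = i.*2 \/ q = i.*2.+1.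
  by exists q./2; lia.
move=> /half[i ik [->|->]] /half[j jk [->|->]];
  rewrite ?cycle_edge_even ?cycle_edge_odd.
- have [->|ij] := eqVneq i j; first by rewrite /near eqxx.
  case/(near_spokes ik jk ij) => E; apply/orP; [left|right].
    by apply: (same_blockP ik); rewrite -E /block_pairs !inE !eqxx ?orbT.
  by apply: (same_blockP jk); rewrite -E /block_pairs !inE !eqxx ?orbT.
- exact: spoke_rim.
- by rewrite near_sym orbC; exact: spoke_rim.
have [->|ij] := eqVneq i j; first by rewrite /near eqxx.
case/(near_rims ik jk) => a [b [ai bj ab]].
have ne E : i = j -> E by move=> eq_ij; rewrite eq_ij eqxx in ij.
have [E|E|E|E] : [\/ j = next_index i, j = next_index (next_index i),
    i = next_index j | i = next_index (next_index j)].
- case: ai bj ab => -> [] -> [E|E|E].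
  + exact: ne.
  + by constructor 1.
  + by constructor 3.
  + by constructor 3.
  + exact: ne (next_inj ik jk (esym E)).
  + by constructor 4.
  + by constructor 1.
  + by constructor 2.
  + exact: ne (next_inj ik jk E).
  + exact: ne (next_inj ik jk E).
  + by constructor 1; exact: next_inj jk (next_lt ik) E.
  + by constructor 3; exact: next_inj ik (next_lt jk) E.
- by rewrite (same_blockP ik) // -E /block_pairs !inE !eqxx ?orbT.
- by rewrite (same_blockP ik) // -E /block_pairs !inE !eqxx ?orbT.
- by rewrite orbC (same_blockP jk) // -E /block_pairs !inE !eqxx ?orbT.
- by rewrite orbC (same_blockP jk) // -E /block_pairs !inE !eqxx ?orbT.
Qed.

Variables (C : eqType) (c0 : C).

(** Outside S, a rim edge conflicts with at most two edges at the outer end of each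
of the two spokes it meets, and a spoke with at most six edges beyond its outer
end.  So the lists have at least six and at least four colours. *)
Lemma long_cycle_colorable (L : {set G} -> seq C) :
  (forall A, A \in edges G -> uniq (L A) /\ 10 <= size (L A)) ->
  colorable L (component_edges r).
Proof.
move=> LP; pose S := [set A in component_edges r | [exists x in A, x \in s]].
have k0 : 0 < k by lia.
have edgeS x y : x \in s -> adj x y -> [set x; y] \in S.
  move=> xs xy; rewrite inE component_edgeP //=; last first.
    by case/and4P: s_cycle => /allP sK _ _ _; exact: sK.
  by apply/existsP; exists x; rewrite !inE eqxx.
apply: (@colorable_from_root _ subcubicG _ c0 r L S (v 0)) => //.
- by apply/subsetP => A; rewrite inE => /andP[].
- exact: v_in.
- by move=> x; apply: edgeS; exact: mem_nth.
move=> L' L'P; set X := component_edges r :\: S in L'P.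
have untouched i : i < k -> ~~ touched X (v i).
  move=> ik; apply/existsP => -[A /andP[]]; rewrite !inE => /andP[AS AK] vA.
  by case/negP: AS; rewrite AK; apply/existsP; exists (v i); rewrite vA mem_nth.
have XE : X \subset edges G by apply: component_edges_sub; exact: subsetDl.
have rim_darts i j : i < k -> j < k -> adj (v i) (v j) -> #|darts X (v i) (v j)| <= 2.
  move=> ik jk vij; apply: leq_trans (card_darts_untouched subcubicG _ (untouched i ik)) _.
  rewrite -[X in _ <= X]muln1 leq_mul2l /= -(cards1 (spoke i)).
  apply/subset_leq_card/subsetP => y; rewrite !inE => /andP[/andP[vy yj] yX].
  have [_ _ sp] := spokeP ik; apply/eqP/sp => //; apply: contraL yX => /(nthP r)[l lk <-].
  exact: untouched.
have sizeL t : t < k.*2 -> uniq (L' (cycle_edge t)) &&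
    ((if odd t then 5 else 3) < size (L' (cycle_edge t))).
  move=> tk; have ik : t./2 < k by lia.
  have tS : cycle_edge t \in S.
    rewrite /cycle_edge; case: ifP => _; apply: edgeS; rewrite ?mem_nth //.
      exact: adj_next.
    by have [] := spokeP ik.
  have [-> le10] := L'P _ tS; rewrite /=.
  move: le10; rewrite /cycle_edge; case: ifP => _ le10.
    have va := adj_next ik; have av := va; rewrite adj_sym in av.
    have := near_darts va XE; have := rim_darts _ _ ik (next_lt ik) va.
    have := rim_darts _ _ (next_lt ik) ik av; move: le10; clear; lia.
  have [va us sp] := spokeP ik; have := near_darts va XE.
  have -> : #|darts X (v t./2) (spoke t./2)| = 0.
    apply/eqP; rewrite -leqn0; apply: leq_trans (card_darts subcubicG _ _ _) _.
    rewrite leqn0 muln_eq0 /= cards_eq0; apply/eqP/setP => y; rewrite !inE.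
    apply/negbTE/negP => /andP[/andP[vy yu] yX].
    have ys : y \notin s.
      by apply: contraL yX => /(nthP r)[l lk <-]; exact: untouched.
    by case/eqP: yu; exact: sp.
  have : #|darts X (spoke t./2) (v t./2)| <= 6.
    apply: leq_trans (card_darts subcubicG _ _ _) _.
    rewrite -[6]/(3 * 2) leq_mul2l /=.
    apply: leq_trans (subset_leq_card (subsetIl _ _)) _.
    rewrite card_others 1?adj_sym //.
    by have := subcubicG (spoke t./2); lia.
  by move: le10; clear; lia.
have [phi [phiL phiP]] := cycle_list_coloring c0 (ltnW s_long) sizeL.
have labP A : A \in S -> exists t : 'I_(k.*2), A == cycle_edge t.
  rewrite inE => /andP[AK /existsP[x /andP[xA /(nthP r)[i ik xE]]]]; subst x.
  have AE : A \in edges G by move: AK; rewrite inE => /andP[].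
  have [y vy ->] := edge_other AE xA.
  have [ys|ys] := boolP (y \in s); last first.
    have [_ _ sp] := spokeP ik; have tk : i.*2 < k.*2 by rewrite ltn_double.
    by exists (Ordinal tk); rewrite cycle_edge_even (sp y).
  move: ys vy => /(nthP r)[j jk <-] vij.
  case: (chordless ik jk vij) => ->.
    have tk : i.*2.+1 < k.*2 by rewrite ltn_Sdouble.
    by exists (Ordinal tk); rewrite cycle_edge_odd.
  have tk : j.*2.+1 < k.*2 by rewrite ltn_Sdouble.
  by exists (Ordinal tk); rewrite cycle_edge_odd setUC.
pose lab A := if [pick t : 'I_(k.*2) | A == cycle_edge t] is Some t then val t else 0.
have {}labP A : A \in S -> lab A < k.*2 /\ A = cycle_edge (lab A).
  move=> /labP[t At]; rewrite /lab; case: pickP => [u /eqP Au|/(_ t)].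
    by split; first exact: ltn_ord.
  by rewrite At.
exists (fun A => phi (lab A)); split=> [A|A B].
  by move=> /labP[lA {2}->]; exact: phiL.
move=> /labP[lA AE] /labP[lB BE]; rewrite {1}AE {1}BE.
have diff t u : same_block t u -> phi t != phi u.
  by move=> /hasP[i]; rewrite mem_iota => ik; exact: (phiP i (t, u)).
case/(near_cycle_edges lA lB)/orP => /diff /eqP //.
by move=> ne E; apply: ne.
Qed.

End LongCycle.
End Cycles.

(** * Colouring a component and the whole graph *)

Section ShortCycle.
Variable G : sgraph.
Hypothesis subcubicG : forall x : G, degree x <= 3.
Variables (C : eqType) (c0 : C) (r : G).
Hypothesis cubic : forall x, x \in component r -> degree x = 3.
Variable L : {set G} -> seq C.
Hypothesis LP : forall A, A \in edges G -> uniq (L A) /\ 10 <= size (L A).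

Lemma realizes_cycle s : 2 < size s -> cycle_in r s ->
  realizes r (nth r s) (cycle_config (size s)).
Proof.
move=> s2 /and4P[/allP sK _ us cs]; set k := size s in s2 *.
have k0 : 0 < k by lia.
have oE : num_labels (cycle_config k) = k by rewrite /num_labels size_mkseq.
have nE i : i < k -> nbr (cycle_config k) i = [:: i.+1 %% k; (i + k).-1 %% k].
  by move=> ik; rewrite /nbr nth_mkseq.
have predE i : i < k -> exists j, [/\ j < k, (i + k).-1 %% k = j & j.+1 %% k = i].
  move=> ik; exists ((i + k).-1 %% k); split=> //; first exact: ltn_pmod.
  rewrite -[_.+1]addn1 modnDml addn1 prednK; last by lia.
  by rewrite modnDr modn_small.
have succ_pred i : i < k -> (i.+1 %% k + k).-1 %% k = i.
  move=> ik; have [j [jk -> jE]] := predE _ (ltn_pmod i.+1 k0).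
  have : (j + 1 == i + 1 %[mod k]) by rewrite !addn1 jE.
  by rewrite eqn_modDr !modn_small // => /eqP.
have nbrP a b : b \in nbr (cycle_config k) a ->
    [/\ a < k, b < k & b = a.+1 %% k \/ a = b.+1 %% k].
  move=> ba; have ak : a < k by rewrite -oE; exact: nbr_lt ba.
  move: ba; rewrite nE // !inE => /orP[]/eqP ->.
    by split; rewrite ?ltn_pmod //; left.
  by have [j [jk -> jE]] := predE a ak; split=> //; right.
have nbrI a b : a < k -> b < k -> b = a.+1 %% k \/ a = b.+1 %% k ->
    b \in nbr (cycle_config k) a.
  move=> ak bk [E|E]; rewrite nE // !inE; first by rewrite E eqxx.
  by rewrite E succ_pred // eqxx orbT.
split=> //.
- by move=> a b; rewrite oE => ak bk /eqP; rewrite nth_uniq // => /eqP.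
- move=> a; case: (ltnP a k) => ak; last by rewrite /nbr nth_default ?size_mkseq.
  rewrite nE //= inE andbT; apply/eqP => E.
  have [j [jk jE ji]] := predE a ak.
  have : (j + 2 == j + 0 %[mod k]).
    have -> : j + 2 = j.+1 + 1 by lia.
    by rewrite -modnDml ji addn1 E jE addn0 modn_small.
  by rewrite eqn_modDl mod0n modn_small.
- by move=> a b /nbrP[ak bk ab]; apply: nbrI => //; case: ab; [right|left].
- by move=> a b /nbrP[]; rewrite oE.
- move=> a b /nbrP[ak bk [->|->]]; first exact: cycle_nth.
  by rewrite adj_sym; exact: cycle_nth.
- by move=> a; rewrite oE => ak; apply/sK/mem_nth.
Qed.

Lemma short_cycle_colorable s t : cycle_in r s ->
  (forall s', cycle_in r s' -> size s <= size s') ->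
  certified (size s) (cycle_config (size s)) t ->
  colorable L (component_edges r).
Proof.
move=> sc smin ct; have s2 : 2 < size s by case/and4P: sc.
apply: (certified_sound subcubicG c0 cubic _ (realizes_cycle s2 sc) ct LP).
move=> s' s'K /andP[s'2 s's] us'; apply/negP => cs'.
have := smin s'; rewrite leqNgt s's; case/(_ _)/negP => //.
by apply/and4P; split=> //; apply/allP.
Qed.

Lemma cubic_component_colorable : colorable L (component_edges r).
Proof.
have ex : exists n, [exists s : n.-tuple G, cycle_in r s].
  have [s sc] := exists_cycle cubic; exists (size s).
  by apply/existsP; exists (in_tuple s).
case: (ex_minnP ex) => n /existsP[[s /= sn] sc] nmin.
have smin s' : cycle_in r s' -> size s <= size s'.
  move=> sc'; rewrite (eqP sn); apply: nmin; apply/existsP.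
  by exists (in_tuple s').
have s2 : 2 < size s by case/and4P: sc.
case: (ltnP 6 (size s)) => s6.
  by refine (long_cycle_colorable cubic subcubicG sc s6 smin c0 LP).
have : size s \in [:: 3; 4; 5; 6] by rewrite !inE; lia.
rewrite !inE => /or4P[] /eqP sE.
- by apply: (short_cycle_colorable sc smin (t := triangle_certificate)); rewrite sE triangle_certified.
- by apply: (short_cycle_colorable sc smin (t := square_certificate)); rewrite sE square_certified.
- by apply: (short_cycle_colorable sc smin (t := pentagon_certificate)); rewrite sE pentagon_certified.
- by apply: (short_cycle_colorable sc smin (t := hexagon_certificate)); rewrite sE hexagon_certified.
Qed.
End ShortCycle.

Lemma component_colorable (G : sgraph) (subcubicG : forall x : G, degree x <= 3)
    (C : eqType) (c0 : C) (L : {set G} -> seq C) (r : G) :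
  (forall A, A \in edges G -> uniq (L A) /\ 10 <= size (L A)) ->
  colorable L (component_edges r).
Proof.
move=> LP.
have [/existsP[v /andP[rv dv]]|/existsPn dP] :=
    boolP [exists v, (v \in component r) && (degree v <= 2)].
  exact: (colorable_deficient subcubicG c0 LP rv dv).
apply: cubic_component_colorable => // x rx; apply/eqP.
by have := dP x; rewrite rx /= -ltnNge eqn_leq subcubicG.
Qed.

(** Edges in different components do not conflict, so the components are coloured
independently. *)
Lemma strong_choosable_10 (G : sgraph) :
  (forall x : G, degree x <= 3) -> strong_choosable G 10.
Proof.
move=> subcubicG C L L10.
have [e0 _|no_edge] := pickP (@predT (edge G)); last first.
  by exists (fun e => match Bool.diff_true_false (no_edge e) with end); split=> e; have := no_edge e.
have [c0 _] : exists c0, c0 \in L e0.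
  by apply/fset0Pn; rewrite -cardfs_gt0; apply: leq_trans (L10 e0).
pose lists (A : {set G}) : seq C :=
  if insub A is Some e then enum_fset (L e) else [::].
have listsE (e : edge G) : lists (val e) = L e by rewrite /lists valK.
have LP A : A \in edges G -> uniq (lists A) /\ 10 <= size (lists A).
  move=> AE; rewrite -[A]/(val (Sub A AE : edge G)) listsE fset_uniq.
  by split; last exact: L10.
have [phi phiP] := fin_all_exists (fun r => component_colorable subcubicG c0 r LP).
have point (e : edge G) : exists x, x \in val e.
  by have /edgesP[x [y [_ ->]]] := valP e; exists x; rewrite !inE eqxx.
pose rep e := fingraph.root (@adj G) (xchoose (point e)).
have symG := sym_connect_sym (@adj_sym G).
have repE (e : edge G) x : x \in val e -> rep e = fingraph.root (@adj G) x.
  move=> xe; apply/eqP; rewrite root_connect //.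
  have pe := xchooseP (point e); have [y xy eE] := edge_other (valP e) xe.
  move: (xchoose _) pe => z; rewrite eE !inE => /orP[]/eqP ->; first exact: connect0.
  by rewrite symG connect1.
have in_comp (e : edge G) : val e \in component_edges (rep e).
  rewrite inE (valP e); apply/subsetP => x xe; rewrite inE (repE e x xe) symG.
  exact: connect_root.
exists (fun e => phi (rep e) (val e)); split=> [e f d ef efd d2|e]; last first.
  by have [phiL _] := phiP (rep e); move: (phiL _ (in_comp e)); rewrite listsE.
have ef_near := near_of_distance ef efd d2.
have rep_ef : rep e = rep f.
  case/nearP: ef_near => _ [x [y [xe yf xy]]]; rewrite (repE e x xe) (repE f y yf).
  case: xy => [-> //|xy]; apply/eqP; rewrite root_connect //; exact: connect1.
have [_ diff] := phiP (rep f); rewrite rep_ef; apply: diff => //.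
by rewrite -rep_ef.
Qed.

Theorem theorem1p4 (G : sgraph) (hG : subcubic G) :
  list_strong_chromatic_index G <= 10.
Proof.
rewrite /list_strong_chromatic_index; case: ex_minnP => m _; apply.
apply/asboolP/strong_choosable_10 => x.
by apply: leq_trans hG; exact: leq_bigmax.
Qed.
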